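(* Let $\Gamma=\mathbb Z$ or $\Gamma=\frac12\mathbb Z$, let $V$ be a conformal vertex algebra with a conjugate linear involution $\phi$, and let $\Upsilon$ be a $\Gamma/\mathbb Z$-grading on $V$ compatible with $\phi$. Let $M$ be an $\Upsilon$-twisted positive energy $V$-module generated by its minimal energy subspace $M_0$. Then the space of $\phi$-invariant Hermitian forms on $M$ is linearly isomorphic to the set of $\omega$-invariant Hermitian forms on the $Zhu_\Upsilon(V)$-module $M_0$.
   Context: Base field $\mathbb C$. A vertex algebra is a vector superspace $V$ with $Y(a,z)=\sum_{n\in\mathbb Z}a_{(n)}z^{-n-1}$, vacuum $\mathbf 1$, translation operator $T$ (i.e. a vertex superalgebra). $p(a)\in\{0,1\}$ is the parity, $p(a,b)=(-1)^{p(a)p(b)}$. Conformal vertex algebra: there is a distinguished $L\in V_2$ with $Y(L,z)=\sum_n L_nz^{-n-2}$, $[L_m,L_n]=(m-n)L_{m+n}+\frac1{12}(m^3-m)\delta_{m+n,0}\,c\,I$, $L_{-1}=T$, $L_0$ diagonalizable, $V=\bigoplus_{n\in\frac12\mathbb Z_{\ge0}}V_n$ ($L_0$-eigenspaces), $\dim V_n<\infty$, $V_0=\mathbb C\mathbf 1$. $\Delta_a$ is the $L_0$-eigenvalue of $a$. A conjugate linear involution $\phi$ of $V$ is a parity preserving conjugate linear map with $\phi^2=I$, $\phi(u_{(n)}v)=\phi(u)_{(n)}\phi(v)$, $\phi(L)=L$. Put $g(a)=e^{-\pi\sqrt{-1}(\Delta_a+\frac12p(a))}\phi(a)$, $A(z)v=e^{zL_1}z^{-2L_0}g(v)$,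 and $\omega(v)=A(1)v=e^{L_1}g(v)$. A $\Gamma/\mathbb Z$-grading $\Upsilon$ is a decomposition $V=\bigoplus_{[\gamma]\in\Gamma/\mathbb Z}V^{[\gamma]}$, $[\gamma]=\gamma+\mathbb Z$, with $V^{[\alpha]}{}_{(n)}V^{[\beta]}\subseteq V^{[\alpha+\beta]}$, $L_0V^{[\gamma]}\subseteq V^{[\gamma]}$; compatible with $\phi$ means $\phi(V^{[\gamma]})\subseteq V^{[\gamma]}$. $\Upsilon$-twisted $V$-module: a superspace $M$ with a parity preserving linear map $a\mapsto Y_M(a,z)=\sum_{m\in[\gamma]}a^M_{(m)}z^{-m-1}$ ($a\in V^{[\gamma]}$, $a^M_{(m)}\in\mathrm{End}\,M$, $a^M_{(m)}v=0$ for $m\gg0$) with $\mathbf 1^M_{(n)}=\delta_{n,-1}I_M$ and, for $a\in V^{[\gamma_a]}$, $b\in V^{[\gamma_b]}$, $m\in[\gamma_a]$, $n\in\mathbb Z$, $k\in[\gamma_b]$, $v\in M$, $$\sum_{j\ge0}\binom mj(a_{(n+j)}b)^M_{(m+k-j)}v=\sum_{j\ge0}(-1)^j\binom nj\big(a^M_{(m+n-j)}b^M_{(k+j)}-p(a,b)(-1)^nb^M_{(k+n-j)}a^M_{(m+j)}\big)v.$$ For $a\in V^{[\gamma]}_{\Delta_a}$ write $Y_M(a,z)=\sum_{n\in[\gamma-\Delta_a]}a^M_nz^{-n-\Delta_a}$. $M$ is positive energy if it has an $\mathbb R$-grading $M=\bigoplus_{j\ge0}M_j$ with $a^M_nM_j\subseteq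 M_{j-n}$; $M_0$ is the minimal energy subspace. Zhu algebra: for $a\in V^{[\gamma]}_{\Delta_a}$ let $\epsilon_a$ be the maximal non-positive real number in the coset $[\gamma-\Delta_a]$ and $\gamma_a=\Delta_a+\epsilon_a$; let $\chi(a,b)=1$ if $\epsilon_a+\epsilon_b\le-1$ and $0$ otherwise. Let $V_\Upsilon=\mathrm{span}\{a\mid\epsilon_a=0\}$, let $J_\Upsilon$ be the span of the elements $\sum_{j\ge0}\binom{\gamma_a}{j}a_{(-2+\chi(a,b)+j)}b$ with $\epsilon_a+\epsilon_b\in\mathbb Z$, and let $a*b=\sum_{j\ge0}\binom{\gamma_a}{j}a_{(-1+j)}b$. It is known that $J_\Upsilon$ is a two-sided ideal of $(V_\Upsilon,* )$ and $Zhu_\Upsilon(V)=V_\Upsilon/J_\Upsilon$ is an associative superalgebra, which acts on $M_0$ by $a\mapsto (a^M_0)|_{M_0}$. For $\Gamma=\mathbb Z$ or $\frac12\mathbb Z$ the map $\omega$ induces a conjugate linear anti-involution of $Zhu_\Upsilon(V)$, also denoted $\omega$ (with $\omega(a*b)=\omega(b)*\omega(a)$). Hermitian forms are conjugate linear in the first argument, linear in the second, and satisfy $(m_1,m_2)=\overline{(m_2,m_1)}$. A Hermitian form on $M$ is $\phi$-invariant if $(m_1,Y_M(a,z)m_2)=(Y_M(A(z)a,z^{-1})m_1,m_2)$ for all $a\in V$, $m_1,m_2\in M$. A Hermitian form on a module over an associative superalgebra $R$ with conjugate linear anti-involution $\omega$ is $\omega$-invariant if $(\omega(a)m_1,m_2)=(m_1,a\,m_2)$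 for all $a\in R$. ''Linearly isomorphic'' means isomorphic as real vector spaces. *)

(* Defs.v *)
From HB Require Import structures.
From mathcomp Require Import all_boot all_order all_algebra generic_quotient.
From mathcomp Require Import finmap complex.
From mathcomp Require Import boolp classical_sets functions cardinality fsbigop.
From mathcomp Require Import reals trigo.

Set Implicit Arguments.
Unset Strict Implicit.
Unset Printing Implicit Defensive.
Import Order.TTheory GRing.Theory Num.Theory.
Local Open Scope classical_set_scope.
Local Open Scope complex_scope.
Local Open Scope ring_scope.

(* The base field is C = R[i] for a realType R.  All infinite sums below are
   the finitely supported sums \sum_(i \in A) of fsbigop. *)

Section LinearAlgebra.
Variables (K : fieldType) (V : lmodType K).

Definition is_subspace (U : set V) : Prop :=
  U 0 /\ forall (c : K) (x y : V), U x -> U y -> U (c *: x + y).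

Record lsubspace := Subspace {
  subspace_set :> V -> Prop;
  subspaceP : is_subspace subspace_set }.

Definition spanned_set (S : set V) : set V :=
  [set v | forall U : set V, is_subspace U -> S `<=` U -> U v].

Lemma spanned_subspace (S : set V) : is_subspace (spanned_set S).
Proof.
split=> [U [U0 _] _ //|c x y Sx Sy U HU SU].
by apply: HU.2; [exact: Sx | exact: Sy].
Qed.

Definition spanned (S : set V) : lsubspace := Subspace (spanned_subspace S).

(* f is the family of components of v in the sum of the W i, i in D. *)
Definition decomposes (I : choiceType) (D : set I) (W : I -> set V)
    (v : V) (f : I -> V) : Prop :=
  [/\ forall i, D i -> W i (f i),
      forall i, ~ D i -> f i = 0,
      finite_set [set i | f i <> 0]
    & v = \sum_(i \in D) f i].

Definition direct_sum (I : choiceType) (D : set I) (W : I -> set V) : Prop :=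
  (forall i, D i -> is_subspace (W i)) /\
  (forall v, exists! f, decomposes D W v f).

Definition component (I : choiceType) (D : set I) (W : I -> set V)
    (v : V) (i : I) : V :=
  xget 0 [set x | exists2 f, decomposes D W v f & x = f i].

Lemma componentE (I : choiceType) (D : set I) (W : I -> set V) v f :
  direct_sum D W -> decomposes D W v f -> component D W v = f.
Proof.
move=> [_ dW] vf; apply/funext => i; apply: xget_unique; first by exists f.
move=> y [f' vf' ->]; have [g [_ gP]] := dW v.
by rewrite -(gP _ vf) -(gP _ vf').
Qed.

Lemma componentP (I : choiceType) (D : set I) (W : I -> set V) v :
  direct_sum D W -> decomposes D W v (component D W v).
Proof.
by move=> dW; have [f [vf _]] := dW.2 v; rewrite (componentE dW vf).
Qed.

Lemma fsbig_lin (W : lmodType K) (I : choiceType) (D : set I) (c : K)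
    (f g : I -> W) :
  finite_set [set i | f i <> 0] -> finite_set [set i | g i <> 0] ->
  \sum_(i \in D) (c *: f i + g i) =
    c *: (\sum_(i \in D) f i) + \sum_(i \in D) g i.
Proof.
move=> ff fg.
pose X := [set i | f i <> 0] `|` [set i | g i <> 0].
have fX : finite_set (D `&` X).
  by apply: finite_setIr; rewrite finite_setU.
have sub h : (forall i, ~ X i -> h i = 0) ->
    \sum_(i \in D) h i = \sum_(i <- fset_set (D `&` X)) h i :> W.
  move=> hX; rewrite -fsbig_finite //; apply/esym/fsbig_widen.
    by move=> i [].
  move=> i [Di nDX]; apply: hX => Xi; exact: nDX.
have f0 i : ~ X i -> f i = 0.
  by move=> nX; apply: contrapT => fi; apply: nX; left.
have g0 i : ~ X i -> g i = 0.
  by move=> nX; apply: contrapT => gi; apply: nX; right.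
rewrite !sub //; last by move=> i nX; rewrite f0 // g0 // scaler0 addr0.
by rewrite big_split /= scaler_sumr.
Qed.

Lemma component_lin (I : choiceType) (D : set I) (W : I -> set V) c u v :
  direct_sum D W -> component D W (c *: u + v) =
    (fun i => c *: component D W u i + component D W v i).
Proof.
move=> dW; apply: (componentE dW).
have [Wu nu fu Eu] := componentP u dW; have [Wv nv fv Ev] := componentP v dW.
split.
- by move=> i Di; apply: (dW.1 i Di).2; [exact: Wu | exact: Wv].
- by move=> i nDi; rewrite nu // nv // scaler0 addr0.
- apply: (@sub_finite_set _ _ ([set i | component D W u i <> 0] `|`
     [set i | component D W v i <> 0])); last by rewrite finite_setU.
  move=> i /= ne0; apply: contrapT => /not_orP[/contrapT u0 /contrapT v0].
  by apply: ne0; rewrite u0 v0 scaler0 addr0.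
- by rewrite {1}Eu {1}Ev fsbig_lin.
Qed.

Lemma component_id (I : choiceType) (D : set I) (W : I -> set V) i v :
  direct_sum D W -> D i -> W i v ->
  component D W v = (fun j => if j == i then v else 0).
Proof.
move=> dW Di Wv; apply: (componentE dW); split.
- by move=> j Dj; case: eqP => [->//|_]; exact: (dW.1 j Dj).1.
- by move=> j nDj; case: eqP => // ji; rewrite ji in nDj.
- apply: (@sub_finite_set _ _ [set i]); last exact: finite_set1.
  by move=> j /=; case: eqP.
- rewrite -(fsbig_widen [set i] D); first by rewrite fsbig_set1 eqxx.
    by move=> j ->.
  by move=> j [_ /= /eqP/negbTE ->].
Qed.

End LinearAlgebra.

Section SubspaceType.
Variables (K : fieldType) (V : lmodType K) (U : lsubspace V).

Definition subspace_pred : {pred V} := fun x => `[< U x >].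

Lemma subspace_submod_closed : submod_closed subspace_pred.
Proof.
have [U0 UD] := subspaceP U; split; first exact/asboolP.
move=> c x y /asboolP Ux /asboolP Uy; apply/asboolP; exact: UD.
Qed.

HB.instance Definition _ :=
  GRing.isSubmodClosed.Build K V subspace_pred subspace_submod_closed.

Record subspace_type := InSubspace {
  subspace_val : V;
  subspace_valP : subspace_val \in subspace_pred }.

HB.instance Definition _ := [isSub for subspace_val].
HB.instance Definition _ := [Choice of subspace_type by <:].
HB.instance Definition _ := [SubChoice_isSubZmodule of subspace_type by <:].
HB.instance Definition _ := [SubZmodule_isSubLmodule of subspace_type by <:].

Definition in_subspace (x : V) (Ux : U x) : subspace_type :=
  InSubspace (introT (asboolP _) Ux).

Lemma subspace_valU (x : subspace_type) : U (subspace_val x).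
Proof. exact/asboolP/(subspace_valP x). Qed.

End SubspaceType.

Section Scalars.
Variable R : realType.

(* exp(i t) *)
Definition expi (t : R) : R[i] := (cos t) +i* (sin t).

Definition gbin (x : R) (j : nat) : R[i] :=
  ((\prod_(i < j) (x - i%:R)) / j`!%:R)%:C.

Definition int_set : set R := [set x | exists n : int, x = n%:~R].
Definition half_int_set : set R := [set x | exists n : int, x = n%:~R / 2%:R].

Definition cosetZ (t : R) : set R := [set x | exists n : int, x = t + n%:~R].

(* the maximal non-positive element of cosetZ t *)
Definition max_nonpos (t : R) : R := t - (Num.ceil t)%:~R.

Definition psign (p q : bool) : R[i] := (-1) ^+ (p && q).

End Scalars.

Section VertexAlgebra.
Variable R : realType.

(* par p is the subspace of vectors of parity p, with p = true odd. *)
Record vertexAlgebra := VertexAlgebra {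
  va_sort :> lmodType R[i];
  par : bool -> set va_sort;
  mode : va_sort -> int -> va_sort -> va_sort;
  vac : va_sort;
  transl : va_sort -> va_sort;
  par_direct : direct_sum [set: bool] par;
  mode_linl : forall (n : int) c a b v,
    mode (c *: a + b) n v = c *: mode a n v + mode b n v;
  mode_linr : forall (n : int) c a u v,
    mode a n (c *: u + v) = c *: mode a n u + mode a n v;
  mode_par : forall p q a b (n : int),
    par p a -> par q b -> par (p (+) q) (mode a n b);
  mode_trunc : forall a b, exists N : int, forall n : int, N <= n ->
    mode a n b = 0;
  vac_even : par false vac;
  vac_mode : forall (n : int) v, mode vac n v = if n == -1 then v else 0;
  mode_vac : forall a, mode a (-1) vac = a;
  mode_vac0 : forall a (n : int), 0 <= n -> mode a n vac = 0;
  transl_vac : transl vac = 0;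
  transl_mode : forall a (n : int) v,
    transl (mode a n v) - mode a n (transl v) = - (n%:~R *: mode a (n - 1) v);
  borcherds : forall p q a b (m n k : int) v, par p a -> par q b ->
    \sum_(j \in [set: nat])
      gbin m%:~R j *: mode (mode a (n + j%:Z) b) (m + k - j%:Z) v =
    \sum_(j \in [set: nat])
      ((-1) ^+ j * gbin n%:~R j) *:
        (mode a (m + n - j%:Z) (mode b (k + j%:Z) v) -
         (psign R p q * (-1) ^ n) *:
           mode b (k + n - j%:Z) (mode a (m + j%:Z) v)) }.

Definition vir (V : vertexAlgebra) (L : V) (n : int) (v : V) : V :=
  mode L (n + 1) v.

(* weight k is the L_0-eigenspace of eigenvalue k/2. *)
Definition weight_of (V : vertexAlgebra) (L : V) (k : nat) : set V :=
  [set v | vir L 0 v = (k%:R / 2%:R) *: v].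

Record conformalVA := ConformalVA {
  cva_sort :> vertexAlgebra;
  Lvec : cva_sort;
  Lvec_even : par false Lvec;
  Lvec_weight : weight_of Lvec 4 Lvec;
  virasoro : exists c : R[i], forall (m n : int) (v : cva_sort),
    vir Lvec m (vir Lvec n v) - vir Lvec n (vir Lvec m v) =
    (m - n)%:~R *: vir Lvec (m + n) v +
    (if m + n == 0 then (m ^+ 3 - m)%:~R / 12%:R * c else 0) *: v;
  vir_transl : forall v : cva_sort, vir Lvec (-1) v = transl v;
  weight_direct : direct_sum [set: nat] (weight_of Lvec);
  weight_findim : forall k : nat, exists s : seq cva_sort,
    weight_of Lvec k `<=` spanned_set [set x | x \in s];
  weight0 : weight_of Lvec 0 = [set v | exists c : R[i], v = c *: vac _] }.

Definition weight (V : conformalVA) : nat -> set V := weight_of (Lvec V).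
Definition wcomp (V : conformalVA) : V -> nat -> V :=
  component [set: nat] (@weight V).
Definition pcomp (V : vertexAlgebra) : V -> bool -> V :=
  component [set: bool] (@par V).

Record conj_involution (V : conformalVA) (phi : V -> V) : Prop :=
  ConjInvolution {
  phi_conj : forall (c : R[i]) u v, phi (c *: u + v) = c^* *: phi u + phi v;
  phi_par : forall p a, par p a -> par p (phi a);
  phiK : forall a, phi (phi a) = a;
  phi_mode : forall u (n : int) v, phi (mode u n v) = mode (phi u) n (phi v);
  phi_L : phi (Lvec V) = Lvec V }.

Section Involution.
Variables (V : conformalVA) (phi : V -> V).

Definition gmap (a : V) : V :=
  \sum_(k \in [set: nat]) \sum_(p : bool)
    expi (- (pi * (k%:R / 2%:R + (p : nat)%:R / 2%:R))) *:
      phi (pcomp (wcomp a k) p).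

(* The coefficient of z^d in A(z)a = e^(z L_1) z^(-2 L_0) g(a): the pair (j, k)
   contributes L_1^j / j! applied to the component of g(a) of weight k/2. *)
Definition Acoef (a : V) (d : int) : V :=
  \sum_(jk \in [set jk : nat * nat | jk.1%:Z - jk.2%:Z = d])
    (jk.1`!%:R)^-1 *: iter jk.1 (vir (Lvec V) 1) (wcomp (gmap a) jk.2).

Definition omega (a : V) : V :=
  \sum_(j \in [set: nat]) (j`!%:R)^-1 *: iter j (vir (Lvec V) 1) (gmap a).

End Involution.

(* The coset gamma + Z is represented by any of its elements gamma, and
   Gam/Z by the elements of Gam in [0, 1). *)
Record is_grading (V : conformalVA) (Gam : set R) (Ups : R -> set V) : Prop :=
  IsGrading {
  Ups_periodic : forall g (n : int), Ups (g + n%:~R) = Ups g;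
  Ups_direct : direct_sum [set g | Gam g /\ 0 <= g < 1] Ups;
  Ups_par : forall g a p, Gam g -> Ups g a -> Ups g (pcomp a p);
  Ups_mode : forall g h a b (n : int), Gam g -> Gam h ->
    Ups g a -> Ups h b -> Ups (g + h) (mode a n b);
  Ups_L0 : forall g a, Gam g -> Ups g a -> Ups g (vir (Lvec V) 0 a) }.

Definition compatible_grading (V : conformalVA) (Gam : set R)
    (Ups : R -> set V) (phi : V -> V) : Prop :=
  forall g a, Gam g -> Ups g a -> Ups g (phi a).

(* tmode a m is the coefficient of z^(-m-1) in Y_M(a, z); for a in Ups g it
   vanishes unless m is in g + Z. *)
Record twistedModule (V : conformalVA) (Gam : set R) (Ups : R -> set V) :=
  TwistedModule {
  tm_sort :> lmodType R[i];
  tpar : bool -> set tm_sort;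
  tmode : V -> R -> tm_sort -> tm_sort;
  tpar_direct : direct_sum [set: bool] tpar;
  tmode_linl : forall m (c : R[i]) a b v,
    tmode (c *: a + b) m v = c *: tmode a m v + tmode b m v;
  tmode_linr : forall m (c : R[i]) a u v,
    tmode a m (c *: u + v) = c *: tmode a m u + tmode a m v;
  tmode_supp : forall g a m v, Gam g -> Ups g a -> ~ cosetZ g m ->
    tmode a m v = 0;
  tmode_par : forall p q a m v, par p a -> tpar q v ->
    tpar (p (+) q) (tmode a m v);
  tmode_trunc : forall g a v, Gam g -> Ups g a ->
    exists N : R, forall m, N <= m -> tmode a m v = 0;
  tmode_vac : forall (n : int) v,
    tmode (vac V) n%:~R v = if n == -1 then v else 0;
  tborcherds : forall p q g h a b m (n : int) k v,
    Gam g -> Gam h -> par p a -> par q b -> Ups g a -> Ups h b ->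
    cosetZ g m -> cosetZ h k ->
    \sum_(j \in [set: nat])
      gbin m j *: tmode (mode a (n + j%:Z) b) (m + k - j%:R) v =
    \sum_(j \in [set: nat])
      ((-1) ^+ j * gbin n%:~R j) *:
        (tmode a (m + n%:~R - j%:R) (tmode b (k + j%:R) v) -
         (psign R p q * (-1) ^ n) *:
           tmode b (k + n%:~R - j%:R) (tmode a (m + j%:R) v)) }.

Section Modules.
Variables (V : conformalVA) (Gam : set R) (Ups : R -> set V).
Variable (M : twistedModule Gam Ups).

(* For a of weight k/2, the operator a^M_n is tmode a (n + k/2 - 1). *)
Record positive_energy (Mgr : R -> set M) : Prop := PositiveEnergy {
  Mgr_direct : direct_sum [set j | 0 <= j] Mgr;
  Mgr_neg : forall j, j < 0 -> Mgr j = [set 0];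
  Mgr_mode : forall g k a n j v, Gam g -> Ups g a -> weight k a ->
    cosetZ (g - k%:R / 2%:R) n -> Mgr j v ->
    Mgr (j - n) (tmode a (n + k%:R / 2%:R - 1) v) }.

Definition generated_by (S : set M) : Prop :=
  forall U : set M, is_subspace U -> S `<=` U ->
    (forall a m v, U v -> U (tmode a m v)) -> U = setT.

Lemma Mgr0_subspace (Mgr : R -> set M) :
  positive_energy Mgr -> is_subspace (Mgr 0).
Proof. by case=> -[+ _] _ _; apply => /=. Qed.

Definition min_energy (Mgr : R -> set M) (HM : positive_energy Mgr) :
  lsubspace M := Subspace (Mgr0_subspace HM).

(* a^M_0, extended linearly from homogeneous a *)
Definition zero_mode (a : V) (v : M) : M :=
  \sum_(k \in [set: nat]) tmode (wcomp a k) (k%:R / 2%:R - 1) v.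

End Modules.

Section Zhu.
Variables (V : conformalVA) (Gam : set R) (Ups : R -> set V).

Definition homog (g : R) (k : nat) : set V :=
  [set a | [/\ Gam g, Ups g a & weight k a]].

Definition eps (g : R) (k : nat) : R := max_nonpos (g - k%:R / 2%:R).
Definition gam (g : R) (k : nat) : R := k%:R / 2%:R + eps g k.
Definition chi (g : R) (k : nat) (h : R) (l : nat) : int :=
  if eps g k + eps h l <= -1 then 1 else 0.

Definition zhuV : lsubspace V :=
  spanned [set a | exists g k, homog g k a /\ eps g k = 0].

Definition zhuJ : lsubspace V :=
  spanned [set x | exists g k h l a b,
    [/\ homog g k a, homog h l b, int_set (eps g k + eps h l) &
        x = \sum_(j \in [set: nat])
              gbin (gam g k) j *: mode a (- 2 + chi g k h l + j%:Z) b]].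

Definition zhu_eq (a b : subspace_type zhuV) : bool :=
  `[< zhuJ (subspace_val a - subspace_val b) >].

Lemma zhu_eq_equiv : equiv_class_of zhu_eq.
Proof.
have [J0 JD] := subspaceP zhuJ.
have JN x : zhuJ x -> zhuJ (- x).
  by move=> Jx; rewrite -scaleN1r -[_ *: _]addr0; exact: JD.
split.
- by move=> a; apply/asboolP; rewrite subrr.
- move=> a b; apply/asboolP/asboolP => /JN; by rewrite opprB.
- move=> b a c /asboolP Jab /asboolP Jbc; apply/asboolP.
  have := JD 1 _ _ Jab Jbc; by rewrite scale1r addrA subrK.
Qed.

Canonical zhu_equiv := EquivRelPack zhu_eq_equiv.

(* Zhu(V) = zhuV / zhuJ.  Its product plays no role in the notion of an
   invariant form, only its action on M_0 and the map induced by omega do.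
   Both are evaluated on chosen representatives; that they do not depend on
   this choice is part of the theory of the Zhu algebra. *)
Definition zhu := {eq_quot zhu_eq}%qT.

Lemma zero_mode_min (M : twistedModule Gam Ups) (Mgr : R -> set M)
    (HM : positive_energy Mgr) (a : V) (v : M) :
  zhuV a -> min_energy HM v -> min_energy HM (zero_mode a v).
Proof.
move=> Va Mv; have [M0 MD] := subspaceP (min_energy HM).
have fin b : finite_set
    [set k : nat | tmode (wcomp b k) (k%:R / 2%:R - 1) v <> 0].
  have [_ _ fb _] := componentP b (@weight_direct V).
  apply: sub_finite_set fb => k /= H b0; apply: H.
  rewrite /wcomp /weight b0.
  have := tmode_linl (k%:R / 2%:R - 1) (-1) (vac V) (vac V) v.
  by rewrite !scaleN1r !addNr.
apply: (Va [set b | min_energy HM (zero_mode b v)]).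
  split=> [|c x y Mx My] /=.
    suff -> : zero_mode 0 v = 0 by [].
    apply: fsbig1 => k _.
    have -> : wcomp (0 : V) k = 0.
      have /(congr1 (@^~ k)) :=
        component_lin (-1) (vac V) (vac V) (@weight_direct V).
      by rewrite /wcomp /weight !scaleN1r !addNr.
    have := tmode_linl (k%:R / 2%:R - 1) (-1) (vac V) (vac V) v.
    by rewrite !scaleN1r !addNr.
  suff -> : zero_mode (c *: x + y) v = c *: zero_mode x v + zero_mode y v.
    exact: MD.
  rewrite /zero_mode -fsbig_lin //; apply: eq_fsbigr => k _.
  by rewrite /wcomp component_lin ?tmode_linl //; exact: weight_direct.
move=> b [g [k [[Gg Ub Wb] e0]]] /=.
suff -> : zero_mode b v = tmode b (0 + k%:R / 2%:R - 1) v.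
  rewrite -[X in Mgr X]subr0; apply: (Mgr_mode HM Gg Ub Wb) => //.
  by exists (- Num.ceil (g - k%:R / 2%:R)); rewrite mulrNz -[LHS]e0.
rewrite add0r /zero_mode -(fsbig_widen [set k] setT) => //.
  by rewrite fsbig_set1 /wcomp (component_id (@weight_direct V) _ Wb) ?eqxx.
move=> l [_ /= /eqP/negbTE lk].
rewrite /wcomp (component_id (@weight_direct V) _ Wb) // lk.
have := tmode_linl (l%:R / 2%:R - 1) (-1) (vac V) (vac V) v.
by rewrite !scaleN1r !addNr.
Qed.

Definition zhu_act (M : twistedModule Gam Ups) (Mgr : R -> set M)
    (HM : positive_energy Mgr) (x : zhu) (v : subspace_type (min_energy HM)) :
    subspace_type (min_energy HM) :=
  in_subspace (zero_mode_min (subspace_valU (repr x)) (subspace_valU v)).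

(* That omega maps zhuV to itself is taken as a datum: it is part of the
   assertion that omega induces a map of Zhu(V), and it forces Lvec to lie in
   Ups 0 (otherwise L_1 need not preserve the grading). *)
Definition zhu_omega (phi : V -> V)
    (Homega : forall a, zhuV a -> zhuV (omega phi a)) (x : zhu) : zhu :=
  \pi_zhu%qT (in_subspace (Homega _ (subspace_valU (repr x)))).

End Zhu.

Definition hermitian_form (W : lmodType R[i]) (B : W -> W -> R[i]) : Prop :=
  [/\ forall (c : R[i]) x y z, B (c *: x + y) z = c^* * B x z + B y z,
      forall (c : R[i]) x y z, B z (c *: x + y) = c * B z x + B z y
    & forall x y, B x y = (B y x)^*].

(* The coefficient of z^e in Y_M(A(z)a, z^(-1))v. *)
Definition YAcoef (V : conformalVA) (Gam : set R) (Ups : R -> set V)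
    (M : twistedModule Gam Ups) (phi : V -> V) (a : V) (e : R) (v : M) : M :=
  \sum_(d \in [set: int]) tmode (Acoef phi a d) (e - d%:~R - 1) v.

(* Equality of the coefficients of z^e for all e. *)
Definition phi_invariant (V : conformalVA) (Gam : set R) (Ups : R -> set V)
    (M : twistedModule Gam Ups) (phi : V -> V) (B : M -> M -> R[i]) : Prop :=
  forall (a : V) (m1 m2 : M) (e : R),
    B m1 (tmode a (- e - 1) m2) = B (YAcoef phi a e m1) m2.

Definition omega_invariant (V : conformalVA) (Gam : set R) (Ups : R -> set V)
    (M : twistedModule Gam Ups) (Mgr : R -> set M) (HM : positive_energy Mgr)
    (phi : V -> V)
    (Homega : forall a, zhuV Gam Ups a -> zhuV Gam Ups (omega phi a))
    (B : subspace_type (min_energy HM) -> subspace_type (min_energy HM) ->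
         R[i]) : Prop :=
  forall (x : zhu Gam Ups) m1 m2,
    B (zhu_act (zhu_omega Homega x) m1) m2 = B m1 (zhu_act x m2).

(* r B1 + B2, for the real vector space structure on forms *)
Definition form_lin (W : lmodType R[i]) (r : R) (B1 B2 : W -> W -> R[i]) :
    W -> W -> R[i] :=
  fun x y => r%:C * B1 x y + B2 x y.

Definition phi_forms (V : conformalVA) (Gam : set R) (Ups : R -> set V)
    (M : twistedModule Gam Ups) (phi : V -> V) : set (M -> M -> R[i]) :=
  [set B | hermitian_form B /\ phi_invariant phi B].

Definition omega_forms (V : conformalVA) (Gam : set R) (Ups : R -> set V)
    (M : twistedModule Gam Ups) (Mgr : R -> set M) (HM : positive_energy Mgr)
    (phi : V -> V)
    (Homega : forall a, zhuV Gam Ups a -> zhuV Gam Ups (omega phi a)) :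
    set (subspace_type (min_energy HM) -> subspace_type (min_energy HM) ->
         R[i]) :=
  [set B | hermitian_form B /\ omega_invariant Homega B].

Definition real_isomorphic (W1 W2 : lmodType R[i])
    (S1 : set (W1 -> W1 -> R[i])) (S2 : set (W2 -> W2 -> R[i])) : Prop :=
  exists F : (W1 -> W1 -> R[i]) -> (W2 -> W2 -> R[i]),
    set_bij S1 S2 F /\
    (forall r B1 B2, S1 B1 -> S1 B2 ->
       F (form_lin r B1 B2) = form_lin r (F B1) (F B2)).

End VertexAlgebra.

Arguments phi_forms {R V Gam Ups} M phi.
Arguments omega_forms {R V Gam Ups M Mgr} HM {phi} Homega.

(* Main.v *)
(* The isomorphism is restriction of forms to M_0.  Write a_n for the modes on
   M and omega for e^{L_1} g.  In terms of modes, phi-invariance says that the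
   adjoint of a_n is omega(a)_{-n}, extended linearly over the weights of
   omega(a).

   The key identity, for a of weight Delta and u = g(a), is
     sum_j binom(m, j) omega(a_(n+j) b)
       = +- sum_(i,l) binom(2 Delta - 2 - m - i - n, l)
                        (L_1^i u / i!)_(n+l) omega(b),
   obtained by moving e^{L_1} past the modes of u and applying Vandermonde.
   For n = 0 it shows that a_n |-> omega(a)_{-n} reverses commutators; for the
   values of n in the definition of J it shows, with the Borcherds identity,
   that omega(J) acts by zero on M_0, as J does.

   A form b on M_0 is extended by zero to M.  Commutators suffice to push the
   raising modes of a word w in the modes to the left, hence
   b(x, w y) = b(w^* x, y) for x, y in M_0, where w^* is the adjoint word.
   Since words applied to M_0 span M, for every x in M there is a unique
   functional f_x with f_x(w y) = b(w^* x, y): the set of x for which it exists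
   contains M_0 and is stable under modes because omega^2 = 1.  Then
   B(x, y) = f_x(y) is the invariant extension.  The same reduction of words
   shows that an invariant form is determined by its restriction to M_0.

   All this needs L in V^[0], so that L_1 respects the grading.  It follows
   from omega(V_Upsilon) being contained in V_Upsilon: if l is the component
   of L in V^[1/2], then l_(1) = 0 because L_0 respects the grading, while
   L_1 l = 0, and skew-symmetry turns l_(1) L into 2 l. *)
From HB Require Import structures.
From mathcomp Require Import all_boot all_order all_algebra generic_quotient.
From mathcomp Require Import complex.
From mathcomp Require Import boolp classical_sets functions cardinality fsbigop.
From mathcomp Require Import reals trigo.
From mathcomp Require Import zify ring lra.
(* Imported last: ssrfun also has a pcomp. *)
Require Import Defs.

Set Implicit Arguments.
Unset Strict Implicit.
Unset Printing Implicit Defensive.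
Import Order.TTheory GRing.Theory Num.Theory.
Local Open Scope classical_set_scope.
Local Open Scope complex_scope.
Local Open Scope ring_scope.

(** * Finite sums and generalized binomial coefficients *)

Section FiniteSums.
Variables (K : fieldType) (V : lmodType K).

Lemma fsum_nat (f : nat -> V) (N : nat) :
  (forall j, (N <= j)%N -> f j = 0) -> \sum_(j \in [set: nat]) f j = \sum_(j < N) f j.
Proof.
move=> f0; rewrite (fsbig_ord _ N f); apply/esym/fsbig_widen => // j [_ /= /negP].
by rewrite -leqNgt => /f0.
Qed.

Lemma fsum_bool (f : bool -> V) :
  \sum_(p \in [set: bool]) f p = f true + f false.
Proof.
rewrite (fsbigE [:: true; false]) ?big_cons ?big_nil ?in_setT //=.
  by rewrite addr0.
by move=> [].
Qed.

Lemma subspace_fsum (I : choiceType) (A : set I) (U : set V) (f : I -> V) :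
  is_subspace U -> (forall i, A i -> U (f i)) -> U (\sum_(i \in A) f i).
Proof.
move=> [U0 UD] Uf; rewrite big_seq; elim/big_ind: _ => //.
  by move=> x y Ux Uy; rewrite -[x]scale1r; exact: UD.
by move=> i; case: finite_supportP => // X XA _ _ /XA; exact: Uf.
Qed.

Lemma subspaceD (U : set V) x y : is_subspace U -> U x -> U y -> U (x + y).
Proof. by move=> [_ UD] Ux Uy; rewrite -[x]scale1r; exact: UD. Qed.

Lemma subspaceZ (U : set V) c x : is_subspace U -> U x -> U (c *: x).
Proof. by move=> [U0 UD] Ux; rewrite -[_ *: _]addr0; exact: UD. Qed.

Lemma subspaceB (U : set V) x y : is_subspace U -> U x -> U y -> U (x - y).
Proof.
by move=> sU Ux Uy; apply: subspaceD => //; rewrite -scaleN1r; exact: subspaceZ.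
Qed.

Lemma subspace_sum (I : Type) (r : seq I) (P : pred I) (U : set V) (f : I -> V) :
  is_subspace U -> (forall i, P i -> U (f i)) -> U (\sum_(i <- r | P i) f i).
Proof.
move=> sU Uf; elim/big_ind: _ => //; first exact: sU.1.
by move=> x y; exact: subspaceD.
Qed.

Lemma fsum_conv (I : choiceType) (A B : set I) (f : I -> V) :
  A `<=` B -> (forall i, B i -> ~ A i -> f i = 0) ->
  \sum_(i \in B) f i = \sum_(i \in A) f i.
Proof. by move=> AB f0; apply/esym/fsbig_widen => // i [/f0]. Qed.

Lemma fsum_one (I : choiceType) (A : set I) (f : I -> V) i :
  A i -> (forall j, A j -> j != i -> f j = 0) -> \sum_(j \in A) f j = f i.
Proof.
move=> Ai f0; rewrite (fsum_conv (A := [set i])) ?fsbig_set1 //.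
  by move=> j ->.
by move=> j Aj /= /eqP; exact: f0.
Qed.

End FiniteSums.

Section Binomials.
Variable R : realType.
Implicit Types (x y : R).

(** The real number underlying [gbin]: the binomial identities are proved over [R] and carried to
    the complex scalars by [gbinE]. *)
Definition rbin x (j : nat) : R := (\prod_(i < j) (x - i%:R)) / j`!%:R.

Lemma gbinE x j : gbin x j = (rbin x j)%:C.
Proof. by []. Qed.

Lemma rbin0 x : rbin x 0 = 1.
Proof. by rewrite /rbin big_ord0 fact0 divr1. Qed.

Lemma rbinS x j : j.+1%:R * rbin x j.+1 = (x - j%:R) * rbin x j.
Proof.
rewrite /rbin big_ord_recr /= factS natrM.
have j0 : (j`!%:R : R) != 0 by rewrite pnatr_eq0 -lt0n fact_gt0.
by field; rewrite j0 nat1r pnatr_eq0.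
Qed.

Lemma rbin1 x : rbin x 1 = x.
Proof. by have := rbinS x 0; rewrite rbin0 mul1r mulr1 subr0. Qed.

Lemma rbin_nat_gt (n j : nat) : (n < j)%N -> rbin n%:R j = 0.
Proof.
by move=> nj; rewrite /rbin (bigD1 (Ordinal nj)) //= subrr !mul0r.
Qed.

(** Induction on [l] after multiplying by l+1 = j + (l+1-j): [rbinS] lowers one binomial in each
    half, and the two halves recombine with the common factor x + y - l. *)
Lemma rbin_Vandermonde x y l :
  \sum_(j < l.+1) rbin x j * rbin y (l - j) = rbin (x + y) l.
Proof.
elim: l => [|l IH]; first by rewrite big_ord1 !rbin0 mulr1.
have l0 : (l.+1%:R : R) != 0 by rewrite pnatr_eq0.
apply: (mulfI l0); rewrite rbinS -IH !mulr_sumr.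
have -> : \sum_(j < l.+2) l.+1%:R * (rbin x j * rbin y (l.+1 - j)) =
    \sum_(j < l.+2) (j%:R * rbin x j) * rbin y (l.+1 - j) +
    \sum_(j < l.+2) rbin x j * ((l.+1 - j)%N%:R * rbin y (l.+1 - j)).
  rewrite -big_split; apply: eq_bigr => j _ /=.
  rewrite natrB; last by have := ltn_ord j; lia.
  ring.
rewrite big_ord_recl mul0r mul0r add0r [X in _ + X]big_ord_recr /= subnn mul0r mulr0 addr0.
rewrite -big_split; apply: eq_bigr => j _ /=.
rewrite /bump /= add1n rbinS subSS subSn; last by have := ltn_ord j; lia.
rewrite rbinS natrB; last by have := ltn_ord j; lia.
ring.
Qed.

Lemma rbin_upper_neg x l : (-1) ^+ l * rbin x l = rbin (l%:R - 1 - x) l.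
Proof.
rewrite /rbin mulrA; congr (_ / _).
rewrite (reindex_inj rev_ord_inj) /= -[l in (-1) ^+ l]card_ord -prodrN.
apply: eq_bigr => i _.
by rewrite natrB ?ltn_ord // -natr1; ring.
Qed.

Lemma rbin_pascal y s : rbin (y + 1) s.+1 = rbin y s.+1 + rbin y s.
Proof.
rewrite -rbin_Vandermonde big_ord_recr big_ord_recr big1 /=; last first.
  move=> i _; rewrite [X in _ * X](rbin_nat_gt (n := 1)) ?mulr0 //.
  by have := ltn_ord i; lia.
by rewrite subSn // !subnn rbin0 rbin1 !mulr1 add0r addrC.
Qed.

Lemma rbin_absorb y s : s.+1%:R * rbin (y + 1) s.+1 = (y + 1) * rbin y s.
Proof. by rewrite rbin_pascal mulrDr rbinS -natr1; ring. Qed.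

Lemma rbin_diag n : rbin n%:R n = 1 :> R.
Proof.
elim: n => [|n IH]; first by rewrite rbin0.
have n0 : (n.+1%:R : R) != 0 by rewrite pnatr_eq0.
have := rbin_Vandermonde (1 : R) n%:R n.+1.
rewrite nat1r => <-; rewrite !big_ord_recl big1; last first.
  by move=> i _; rewrite (rbin_nat_gt (n := 1)) ?mul0r.
by rewrite rbin0 mul1r rbin_nat_gt // add0r rbin1 mul1r subSS subn0 IH addr0.
Qed.

Lemma rbin_N1 j : rbin (-1) j = (-1) ^+ j :> R.
Proof.
have := rbin_upper_neg (-1) j; rewrite opprK subrK rbin_diag => /(congr1 ( *%R ((-1) ^+ j))).
by rewrite mulrA -expr2 sqrr_sign mul1r mulr1.
Qed.

End Binomials.

(** * Semilinear maps and vertex algebras *)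

Section Semilinear.
Variables (K : fieldType) (s : {rmorphism K -> K}) (U W : lmodType K).

(** Linear maps ([s] the identity) and conjugate linear maps ([s] the complex conjugation) share one
    set of lemmas this way. *)
Definition semilin (f : U -> W) : Prop :=
  forall c x y, f (c *: x + y) = s c *: f x + f y.

Variable f : U -> W.
Hypothesis fL : semilin f.

Lemma semilin0 : f 0 = 0.
Proof.
have := fL 1 0 0; rewrite scaler0 addr0 rmorph1 scale1r => /eqP.
by rewrite eq_sym addrC -subr_eq0 addrK => /eqP.
Qed.

Lemma semilinD x y : f (x + y) = f x + f y.
Proof. by rewrite -[x]scale1r fL rmorph1 !scale1r. Qed.

Lemma semilinZ c x : f (c *: x) = s c *: f x.
Proof. by rewrite -[_ *: _]addr0 fL semilin0 addr0. Qed.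

Lemma semilinN x : f (- x) = - f x.
Proof. by rewrite -!scaleN1r semilinZ rmorphN rmorph1. Qed.

Lemma semilinB x y : f (x - y) = f x - f y.
Proof. by rewrite semilinD semilinN. Qed.

Lemma semilin_sum (I : Type) (r : seq I) (P : pred I) (g : I -> U) :
  f (\sum_(i <- r | P i) g i) = \sum_(i <- r | P i) f (g i).
Proof. exact: (big_morph f semilinD semilin0). Qed.

Lemma semilin_fsum (I : choiceType) (A : set I) (g : I -> U) :
  finite_set [set i | g i <> 0] ->
  f (\sum_(i \in A) g i) = \sum_(i \in A) f (g i).
Proof.
move=> gfin; pose B := A `&` [set i | g i <> 0].
have Bfin : finite_set B by exact: finite_setIr.
have g0 i : A i -> ~ B i -> g i = 0.
  by move=> Ai nB; apply: contrapT => gi; apply: nB.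
rewrite (fsum_conv (A := B)) //; last by move=> i [].
rewrite [RHS](fsum_conv (A := B)) //; last 2 first.
- by move=> i [].
- by move=> i Ai nB; rewrite g0 // semilin0.
by rewrite !fsbig_finite // semilin_sum.
Qed.

(** The images of the components of [v] decompose [f v], and decompositions are unique. *)
Lemma component_semilin (I : choiceType) (D : set I) (P : I -> set U)
    (Q : I -> set W) v i :
  direct_sum D P -> direct_sum D Q ->
  (forall j x, D j -> P j x -> Q j (f x)) ->
  component D Q (f v) i = f (component D P v i).
Proof.
move=> dP dQ fPQ; rewrite (@componentE _ _ _ _ _ _ (fun j => f (component D P v j))) //.
have [Pv nv finv Ev] := componentP v dP; split.
- by move=> j Dj; apply: fPQ => //; exact: Pv.
- by move=> j nDj; rewrite nv // semilin0.
- by apply: sub_finite_set finv => j /= fj pj; apply: fj; rewrite pj semilin0.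
- by rewrite {1}Ev semilin_fsum.
Qed.

End Semilinear.

Notation lin := (semilin idfun).

Section Components.
Variables (K : fieldType) (U : lmodType K).
Variables (I : choiceType) (D : set I) (P : I -> set U).
Hypothesis dP : direct_sum D P.

Lemma component_is_lin i : lin (fun v => component D P v i).
Proof. by move=> c x y; rewrite component_lin. Qed.

Lemma component_finite v : finite_set [set i | component D P v i <> 0].
Proof. by have [] := componentP v dP. Qed.

Lemma component_sum v : v = \sum_(i \in D) component D P v i.
Proof. by have [] := componentP v dP. Qed.

Lemma component_in v i : D i -> P i (component D P v i).
Proof. by have [+ _ _ _] := componentP v dP; apply. Qed.

Lemma component_same v i : D i -> P i v -> component D P v i = v.
Proof. by move=> Di Pv; rewrite (component_id dP Di Pv) eqxx. Qed.

Lemma component_other v i j :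
  D i -> P i v -> j != i -> component D P v j = 0.
Proof. by move=> Di Pv /negbTE ji; rewrite (component_id dP Di Pv) ji. Qed.

Lemma component_ind (S : set U) : is_subspace S ->
  (forall i v, D i -> P i v -> S v) -> forall v, S v.
Proof.
move=> sS H v; rewrite (component_sum v); apply: subspace_fsum => // i Di.
by apply: (H i) => //; exact: component_in.
Qed.

End Components.

(** * Consequences of the Borcherds identity: commutators and skew-symmetry *)

Section VertexAlgebraTheory.
Variables (R : realType) (V : vertexAlgebra R).
Implicit Types (a b u v w : V).

Lemma mode_is_linl n v : lin (fun a : V => mode a n v).
Proof. by move=> c x y; exact: mode_linl. Qed.

Lemma mode_is_linr a n : lin (mode a n).
Proof. by move=> c x y; exact: mode_linr. Qed.

Lemma mode0l n v : mode (0 : V) n v = 0.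
Proof. exact: (semilin0 (mode_is_linl n v)). Qed.

Lemma mode0r a n : mode a n 0 = 0.
Proof. exact: (semilin0 (mode_is_linr a n)). Qed.

(** The Borcherds identity at n = 0, where binom(0, j) leaves only j = 0 on the right. *)
Lemma mode_comm p q a b (m k : int) v : par p a -> par q b ->
  \sum_(j \in [set: nat])
      gbin m%:~R j *: mode (mode a j%:Z b) (m + k - j%:Z) v =
  mode a m (mode b k v) - psign R p q *: mode b k (mode a m v).
Proof.
move=> pa qb; have := borcherds m 0 k v pa qb.
under eq_fsbigr do rewrite add0r.
move=> ->; rewrite (@fsum_nat _ _ _ 1); last first.
  move=> j j0; rewrite gbinE mulr0z -[0]/(0%:R) rbin_nat_gt //.
  by rewrite mulr0 scale0r.
rewrite big_ord1 /= gbinE rbin0 expr0 mulr1 scale1r.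
by rewrite -[Posz 0]/(0 : int) !(addr0, subr0) expr0z mulr1.
Qed.

Lemma mode_comm_nat a b (m : nat) (k : int) v : par false a ->
  \sum_(j < m.+1) gbin m%:R j *: mode (mode a j%:Z b) (m%:Z + k - j%:Z) v =
  mode a m%:Z (mode b k v) - mode b k (mode a m%:Z v).
Proof.
move=> pa; move: b; apply: (component_ind (@par_direct R V)).
  split=> [|c x y Hx Hy].
    by rewrite !mode0l mode0r subrr; apply: big1 => j _; rewrite mode0r mode0l scaler0.
  rewrite !mode_linl mode_linr opprD addrACA -scalerBr -Hx -Hy scaler_sumr -big_split.
  apply: eq_bigr => j _; rewrite mode_linr mode_linl scalerDr /=.
  by rewrite !scalerA mulrC.
move=> q b _ qb; have := mode_comm m%:Z k v pa qb.
rewrite /psign /= expr0 scale1r => <-.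
rewrite (@fsum_nat _ _ _ m.+1) //.
by move=> j mj; rewrite gbinE rbin_nat_gt // scale0r.
Qed.

(** The Borcherds identity at m = -1, k = 0 on the vacuum: the modes b_(j), j >= 0, kill it, and
    a_(-1+j) does so unless j = 0, so one term is left on the right. The vector x_(-1-j) applied to
    the vacuum stands for T^j x / j!. *)
Lemma skew_symmetry p q a b (n : int) : par p a -> par q b ->
  mode b n a = - (psign R p q * (-1) ^ n) *: \sum_(j \in [set: nat])
    (-1) ^+ j *: mode (mode a (n + j%:Z) b) (- 1 - j%:Z) (vac V).
Proof.
move=> pa qb; have := borcherds (-1) n 0 (vac V) pa qb.
rewrite [X in _ = X -> _](@fsum_nat _ _ _ 1); last first.
  case=> // j _; rewrite mode_vac0 // mode0r mode_vac0; last by lia.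
  by rewrite mode0r scaler0 subrr scaler0.
rewrite big_ord1 /= mode_vac0 // mode0r -[Posz 0]/(0 : int) add0r subr0 addr0 mode_vac gbinE rbin0.
rewrite expr0 mulr1 scale1r add0r.
under eq_fsbigr => j _.
  rewrite gbinE mulrNz rbin_N1.
  have -> : ((-1) ^+ j)%:C = (-1) ^+ j :> R[i] by rewrite rmorphXn rmorphN.
  over.
move=> ->; rewrite scalerN scaleNr opprK scalerA.
have -> : psign R p q * (-1) ^ n * (psign R p q * (-1) ^ n) = 1 :> R[i].
  rewrite mulrACA -expr2 sqrr_sign mul1r.
  by rewrite -expfzMl mulrNN mulr1 exp1rz.
by rewrite scale1r.
Qed.

Lemma skew_symmetry1 a b (n : int) : par false a -> par false b ->
  (forall j, (0 < j)%N -> mode (mode a (n + j%:Z) b) (- 1 - j%:Z) (vac V) = 0) ->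
  mode b n a = - (-1) ^ n *: mode a n b.
Proof.
move=> pa pb H; rewrite (skew_symmetry n pa pb) (@fsum_nat _ _ _ 1).
  by rewrite big_ord1 /= scale1r -[Posz 0]/(0 : int) addr0 subr0 mode_vac mul1r.
by move=> j /H ->; rewrite scaler0.
Qed.

Lemma pcomp_par a p : par p (pcomp a p).
Proof. exact: (component_in (@par_direct R V)). Qed.

Lemma pcomp_sum a : a = pcomp a true + pcomp a false.
Proof. by rewrite {1}(component_sum (@par_direct R V) a) fsum_bool. Qed.

Lemma pcomp_id a p : par p a -> pcomp a p = a.
Proof. exact: (component_same (@par_direct R V)). Qed.

Lemma pcomp_0 a p q : par p a -> q != p -> pcomp a q = 0.
Proof. exact: (component_other (@par_direct R V)). Qed.

Lemma pcomp_is_lin p : lin (fun a : V => pcomp a p).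
Proof. exact: (component_is_lin (@par_direct R V)). Qed.

Lemma par_subspace p : is_subspace (par p : set V).
Proof. exact: ((@par_direct R V).1 p). Qed.

End VertexAlgebraTheory.

(** * Re-indexing of finite sums *)

Section SumReindexing.
Variable U : nmodType.

Lemma sum_ord_shift (K : nat) (f : nat -> U) : f 0 = 0 -> f K = 0 ->
  \sum_(s < K) f s.+1 = \sum_(s < K) f s.
Proof.
case: K => [|K] f0 fK; first by rewrite !big_ord0.
rewrite [LHS]big_ord_recr [RHS]big_ord_recl /= f0 fK addr0 add0r.
by apply: eq_bigr => i _.
Qed.

Lemma sum_triangle (K : nat) (f : nat -> nat -> U) :
  (forall j s, (K <= j + s)%N -> f j s = 0) ->
  \sum_(j < K) \sum_(s < K) f j s = \sum_(l < K) \sum_(j < l.+1) f j (l - j)%N.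
Proof.
move=> f0.
transitivity (\sum_(j < K) \sum_(l < K | (j <= l)%N) f j (l - j)%N); last first.
  rewrite (exchange_big_dep xpredT) //=; apply: eq_bigr => l _.
  rewrite (big_ord_widen_cond K xpredT (fun j => f j (l - j)%N)) //.
rewrite /=; apply: eq_bigr => j _.
have jK : (j <= K)%N by exact/ltnW.
rewrite -(big_mkord xpredT) -(big_mkord (fun l => j <= l)%N (fun l => f j (l - j)%N)).
rewrite (big_cat_nat (n := K - j)) ?leq_subr //= [X in _ + X]big_nat_cond.
rewrite [X in _ + X]big1 ?addr0; last by move=> s /andP[/andP[sK _] _]; apply: f0; lia.
rewrite [RHS](big_cat_nat (n := j)) //= [X in X + _]big_nat_cond [X in X + _]big1 ?add0r; last first.
  by move=> l /andP[/andP[_ lj]]; rewrite leqNgt lj.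
rewrite -{3}[nat_of_ord j]add0n big_addn big_mkcond [LHS]big_nat_cond [RHS]big_nat_cond /=.
by apply: eq_big => s; rewrite ?leq_addl ?addnK.
Qed.

End SumReindexing.

(** * Commutation of L_0 and L_1 with modes; doubled weights *)

Section ConformalTheory.
Variables (R : realType) (V : conformalVA R).
Implicit Types (a b u v w : V).

Local Notation L := (Lvec V).
Local Notation L0 := (vir L 0).
Local Notation D := (vir L 1).

Lemma vir_is_lin n : lin (vir L n).
Proof. exact: mode_is_linr. Qed.

(** The commutator formula for L_(0) = T gives (T a)_(n) = [T, a_(n)], which [transl_mode]
    evaluates. *)
Lemma mode_transl a n v : mode (transl a) n v = - (n%:~R *: mode a (n - 1) v).
Proof.
have := mode_comm_nat a 0 n v (@Lvec_even _ V).
rewrite big_ord1 gbinE rbin0 scale1r -[Posz 0]/(0 : int) add0r subr0.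
by rewrite -[mode L 0 _]/(vir L (-1) _) -![mode L 0 _]/(vir L (-1) _) !vir_transl transl_mode.
Qed.

Lemma vir0_mode a n v :
  L0 (mode a n v) = mode (L0 a) n v - (n + 1)%:~R *: mode a n v + mode a n (L0 v).
Proof.
have := mode_comm_nat a 1 n v (@Lvec_even _ V).
rewrite !big_ord_recl big_ord0 !gbinE rbin0 rbin1 !scale1r addr0 /=.
rewrite -[mode L 0%:Z a]/(vir L (-1) a) vir_transl mode_transl.
rewrite /vir /bump /= !add0r !addn0 => /eqP; rewrite eq_sym subr_eq => /eqP ->.
rewrite (_ : Posz 1 + n - 1 = n); last by lia.
rewrite (_ : Posz 1 + n = n + 1); last by lia.
by rewrite addr0 [X in X + _]addrC.
Qed.

(** L_1 is the mode L_(2), so the commutator formula has three terms, with L_(-1) a, L_0 a and L_1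
    a; the first is rewritten by [mode_transl]. *)
Lemma vir1_mode a n v :
  D (mode a n v) = 2 *: mode (L0 a) (n + 1) v - (n + 2)%:~R *: mode a (n + 1) v
    + mode (D a) n v + mode a n (D v).
Proof.
have := mode_comm_nat a 2 n v (@Lvec_even _ V).
rewrite !big_ord_recl big_ord0 !gbinE rbin0 rbin1 rbin_diag !scale1r addr0 /=.
rewrite -[mode L 0%:Z a]/(vir L (-1) a) vir_transl mode_transl.
rewrite /vir /bump /= !add0r !addn0 add1n => /eqP; rewrite eq_sym subr_eq => /eqP ->.
rewrite (_ : Posz 2 + n - 1 = n + 1); last by lia.
rewrite (_ : Posz 2 + n - 2 = n); last by lia.
rewrite (_ : Posz 2 + n = n + 2); last by lia.
rewrite addr0 rmorph_nat !addrA; congr (_ + _ + _); exact: addrC.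
Qed.

(* As weight, with x/2 allowed to be negative; then v = 0 (hwt_lt0). *)
Definition hwt (x : int) (v : V) : Prop := vir L 0 v = (x%:~R / 2%:R) *: v.

Lemma hwt_subspace x : is_subspace (hwt x).
Proof.
split; rewrite /hwt.
  by rewrite (semilin0 (vir_is_lin 0)) scaler0.
move=> c u v; rewrite vir_is_lin => -> ->.
by rewrite scalerDr !scalerA mulrC.
Qed.

Lemma wcomp_is_lin k : lin (fun v : V => wcomp v k).
Proof. exact: (component_is_lin (@weight_direct _ V)). Qed.

Lemma wcomp_finite v : finite_set [set k | wcomp v k <> 0].
Proof. exact: (component_finite (@weight_direct _ V)). Qed.

Lemma wcomp_sum v : v = \sum_(k \in [set: nat]) wcomp v k.
Proof. exact: (component_sum (@weight_direct _ V)). Qed.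

Lemma wcomp_hwt v k : hwt k%:Z (wcomp v k).
Proof. exact: (component_in (@weight_direct _ V)). Qed.

Lemma hwt_ind (S : set V) : is_subspace S ->
  (forall (k : nat) a, hwt k a -> S a) -> forall a, S a.
Proof.
by move=> sS H; apply: (component_ind (@weight_direct _ V)) => // k a _; exact: H.
Qed.

Lemma wcomp_vir0 v k : wcomp (vir L 0 v) k = (k%:R / 2%:R) *: wcomp v k.
Proof.
rewrite /wcomp (component_semilin (vir_is_lin 0) v k (@weight_direct _ V) (@weight_direct _ V)).
  exact: wcomp_hwt.
move=> j x _ jx; rewrite /weight_of /= {1}(jx : _ = _).
exact: (semilinZ (vir_is_lin 0)).
Qed.

(** Taking components of weight k/2 in the eigenvalue equation gives (x - k)/2 times the component
    equal to 0. A negative [x] is allowed, whence [hwt_lt0]. *)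
Lemma wcomp_other x v (k : nat) : hwt x v -> k%:Z != x -> wcomp v k = 0.
Proof.
move=> xv kx; have := wcomp_vir0 v k; rewrite xv (semilinZ (wcomp_is_lin k)) /=.
move=> /eqP; rewrite -subr_eq0 -scalerBl scaler_eq0 => /orP[|/eqP //].
rewrite -mulrBl mulf_eq0 invr_eq0 pnatr_eq0 orbF subr_eq0 -[k%:R]/(k%:Z%:~R) eqr_int.
by rewrite eq_sym (negbTE kx).
Qed.

Lemma wcomp_same (k : nat) v : hwt k v -> wcomp v k = v.
Proof. exact: (component_same (@weight_direct _ V)). Qed.

Lemma hwt_lt0 x v : hwt x v -> x < 0 -> v = 0.
Proof.
move=> xv x0; rewrite (wcomp_sum v) fsbig1 // => k _.
by apply: wcomp_other xv _; lia.
Qed.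

Lemma hwt_mode x y n a b : hwt x a -> hwt y b ->
  hwt (x + y - 2 * n - 2) (mode a n b).
Proof.
rewrite /hwt => xa yb; rewrite vir0_mode xa yb.
rewrite (semilinZ (mode_is_linl n b)) (semilinZ (mode_is_linr a n)) /=.
rewrite -scalerBl -scalerDl; congr (_ *: _).
by rewrite !intrD !mulrNz !intrM; field.
Qed.

Lemma hwt_vir1 x v : hwt x v -> hwt (x - 2) (D v).
Proof.
rewrite /hwt => xv; have [c /(_ 0 1 v)] := @virasoro _ V.
rewrite /= scale0r addr0 [vir _ 0 v]xv (semilinZ (vir_is_lin 1)) /= => /eqP.
rewrite subr_eq => /eqP ->.
rewrite -scalerDl; congr (_ *: _).
by rewrite !intrD mulrNz; field.
Qed.

(** An explicit form of truncation; it provides bounds that are uniform over a whole family of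
    sums. *)
Lemma hwt_mode0 x y n a b : hwt x a -> hwt y b -> x + y < 2 * n + 2 ->
  mode a n b = 0.
Proof. by move=> xa yb lt; apply: (hwt_lt0 (hwt_mode n xa yb)); lia. Qed.

End ConformalTheory.

(** * The exponential of L_1 *)

Section ExpVir1.
Variables (R : realType) (V : conformalVA R).
Implicit Types (a b u v w : V).

Local Notation D := (vir (Lvec V) 1).

(* D^t / t!, vanishing for negative t *)
Definition divpow (t : int) (v : V) : V :=
  if t is Posz j then (j`!%:R)^-1 *: iter j D v else 0.

Arguments divpow : simpl never.

Lemma divpow_is_lin t : lin (divpow t).
Proof.
case: t => [j|j] c x y; last by rewrite /divpow scaler0 addr0.
rewrite /divpow [RHS]addrC scalerA mulrC -scalerA [RHS]addrC -scalerDr; congr (_ *: _).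
by elim: j => //= j ->; rewrite vir_is_lin.
Qed.

Lemma divpow0 v : divpow 0 v = v.
Proof. by rewrite /divpow /= fact0 invr1 scale1r. Qed.

Lemma divpow1 v : divpow 1 v = D v.
Proof. by rewrite /divpow /= factS fact0 invr1 scale1r. Qed.

(** Valid for all integers: at t = -1 the coefficient vanishes. This spares boundary cases in
    [divpow_mode]. *)
Lemma vir1_divpow t v : D (divpow t v) = (t + 1)%:~R *: divpow (t + 1) v.
Proof.
case: t => [j|[|j]]; last 2 first.
- by rewrite /divpow scale0r (semilin0 (vir_is_lin 1)).
- by rewrite (_ : Negz j.+1 + 1 = Negz j) /divpow ?(semilin0 (vir_is_lin 1)) ?scaler0 // ; lia.
rewrite (_ : Posz j + 1 = Posz j.+1); last by lia.
rewrite /divpow (semilinZ (vir_is_lin 1)) /= scalerA factS natrM invfM mulrA.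
by rewrite -pmulrn divff ?mul1r // pnatr_eq0.
Qed.

Lemma hwt_divpow x t v : hwt x v -> hwt (x - 2 * t) (divpow t v).
Proof.
case: t => [j|j] xv; last exact: (hwt_subspace V _).1.
apply: subspaceZ; first exact: hwt_subspace.
elim: j => [|j IH] /=; first by rewrite mulr0 subr0.
by have := hwt_vir1 IH; congr hwt; lia.
Qed.

Lemma divpow_eq0 x t v : hwt x v -> x < 2 * t -> divpow t v = 0.
Proof. by move=> xv lt; apply: (hwt_lt0 (hwt_divpow t xv)); lia. Qed.

Lemma divpow_nilp v : exists N : nat, forall j, (N <= j)%N -> divpow j%:Z v = 0.
Proof.
move: v; apply: hwt_ind.
  split=> [|c x y [N HN] [P HP]].
    by exists 0 => j _; rewrite (semilin0 (divpow_is_lin j)).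
  exists (maxn N P) => j; rewrite geq_max => /andP[Nj Pj].
  by rewrite divpow_is_lin HN // HP // scaler0 addr0.
move=> k a ka; exists k.+1 => j kj; apply: (divpow_eq0 ka); lia.
Qed.

Definition expD (v : V) : V := \sum_(j \in [set: nat]) divpow j v.

Lemma expDE N v : (forall j, (N <= j)%N -> divpow j%:Z v = 0) ->
  expD v = \sum_(j < N) divpow j v.
Proof. exact: fsum_nat. Qed.

Lemma expD_hwt x v N : hwt x v -> (`|x| < N)%N -> expD v = \sum_(j < N) divpow j v.
Proof.
by move=> xv xN; apply: expDE => j Nj; apply: (divpow_eq0 xv); lia.
Qed.

Lemma expD_is_lin : lin expD.
Proof.
move=> c x y; have [N HN] := divpow_nilp x; have [P HP] := divpow_nilp y.
rewrite !(@expDE (maxn N P)); last 3 first.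
- by move=> j; rewrite geq_max => /andP[_ /HP].
- by move=> j; rewrite geq_max => /andP[/HN].
- move=> j; rewrite geq_max => /andP[Nj Pj].
  by rewrite divpow_is_lin HN // HP // scaler0 addr0.
rewrite scaler_sumr -big_split; apply: eq_bigr => j _; exact: divpow_is_lin.
Qed.

(* The coefficient of (L_1^i u / i!)_(n+s) e^{L_1} in e^{L_1} u_(n), for u of
   weight x/2. *)
Definition expcoef (x n : int) (i s : nat) : R :=
  (-1) ^+ s * rbin (i%:R + (n - x + 1)%:~R + s%:R) s.

(** The recurrence needed in [divpow_mode]. When L_1 is applied once more, the term (i, s) comes
    from (i, s-1) through the L_0 part of [vir1_mode] and from (i-1, s) through its L_1 part. It
    follows from absorption and Pascal's rule. *)
Lemma expcoef_rec x n i s : (i + s)%:R * expcoef x n i s =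
  (if s is s'.+1 then expcoef x n i s' * (x - 2 * i%:Z - n - s%:Z - 1)%:~R else 0)
  + (if i is i'.+1 then i%:R * expcoef x n i' s else 0).
Proof.
have E (y : R) j : y + j.+1%:R = y + j%:R + 1 by rewrite -natr1 addrA.
rewrite /expcoef; case: s => [|s].
  rewrite !rbin0 !expr0 mulr1 addn0 add0r; case: i => [|i]; rewrite ?rbin0 !mulr1 //.
set X := (n - x + 1)%:~R.
rewrite (E _ s) exprS.
have A := rbin_absorb (i%:R + X + s%:R) s.
have P := rbin_pascal (i%:R + X + s%:R) s.
have -> : (x - 2 * i%:Z - n - s.+1%:Z - 1)%:~R = - (X + 2 * i%:R + s.+1%:R) :> R.
  by rewrite /X !(intrD, mulrNz, intrM) -!pmulrn -natr1; ring.
rewrite natrD mulrDl mulrCA [X in _ + X]mulrCA A.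
case: i A P => [|i] A P.
  by rewrite mul0r mulr0 add0r addr0 -natr1; ring.
have -> : i%:R + X + s.+1%:R = i.+1%:R + X + s%:R :> R by rewrite -!natr1; ring.
by rewrite P; rewrite -!natr1; ring.
Qed.

(** A Leibniz rule for divided powers, by induction on [N]. Terms with i + s > N vanish since
    [divpow] is zero at negative exponents, so any square of side K > N may serve as the range. *)
Lemma divpow_mode x u n v (N K : nat) : hwt x u -> (N < K)%N ->
  divpow N (mode u n v) = \sum_(i < K) \sum_(s < K)
    (expcoef x n i s)%:C *: mode (divpow i u) (n + s%:Z) (divpow (N%:Z - i%:Z - s%:Z) v).
Proof.
move=> xu; elim: N => [|N IH] NK.
  case: K NK => // K _; rewrite big_ord_recl [X in _ + X]big1 ?addr0; last first.
    move=> i _; apply: big1 => s _.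
    by rewrite (_ : 0%:Z - _ - _ = Negz (i + s)) ?mode0r ?scaler0 // /= /bump; lia.
  rewrite big_ord_recl [X in _ + X]big1 ?addr0; last first.
    move=> s _.
    by rewrite (_ : 0%:Z - _ = Negz s) ?mode0r ?scaler0 // /= /bump; lia.
  have dE w : divpow (Posz 0) w = w by exact: divpow0.
  by rewrite /expcoef rbin0 mulr1 scale1r !dE.
have N0 : (N.+1%:R : R[i]) != 0 by rewrite pnatr_eq0.
apply: (scalerI N0).
have := vir1_divpow N (mode u n v); rewrite (_ : Posz N + 1 = N.+1); last by lia.
rewrite -[_%:~R]/(N.+1%:R) => <-.
rewrite IH; last by lia.
pose G i s t := mode (divpow i u) (n + s%:Z) (divpow t v).
pose t i s : int := N.+1%:Z - i%:Z - s%:Z.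
pose A i s := (if s is s'.+1 then expcoef x n i s' * (x - 2 * i%:Z - n - s%:Z - 1)%:~R else 0).
pose B i s := (if i is i'.+1 then i%:R * expcoef x n i' s else 0).
(* The three summands raise [s], [i] and the exponent on [v] respectively; [t i s] is that exponent
   in degree N+1. *)
have DG (i s : nat) : D (mode (divpow i u) (n + s%:Z) (divpow (N%:Z - i%:Z - s%:Z) v)) =
   (x - 2 * i%:Z - n - s.+1%:Z - 1)%:~R%:C *: G i s.+1 (t i s.+1) +
   i.+1%:R%:C *: G i.+1 s (t i.+1 s) + (t i s)%:~R%:C *: G i s (t i s).
  rewrite vir1_mode (hwt_divpow i xu) !vir1_divpow.
  rewrite (semilinZ (mode_is_linl _ _) (_ / 2)) (semilinZ (mode_is_linl _ _) (i%:Z + 1)%:~R).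
  rewrite (semilinZ (mode_is_linr _ _) (_ + 1)%:~R) scalerA -scalerBl /G /t.
  congr (_ *: mode _ _ (divpow _ _) +
    _ *: mode (divpow _ _) _ (divpow _ _) + _ *: mode _ _ (divpow _ _)); try lia.
  - by rewrite !(intrD, mulrNz, intrM) !rmorphD !rmorphN /= !rmorphM /= !rmorph_int rmorph1; field.
  - by rewrite [RHS]rmorph_nat -[RHS]/(i.+1%:Z%:~R); congr (_%:~R); lia.
  - by rewrite [RHS]rmorph_int; congr (_%:~R); lia.
rewrite (semilin_sum (vir_is_lin 1)).
under eq_bigr => i _.
  rewrite (semilin_sum (vir_is_lin 1)).
  under eq_bigr => s _ do rewrite (semilinZ (vir_is_lin 1)) DG !scalerDr !scalerA /=.
  rewrite !big_split /=.
  (* The shift in [s] costs nothing: [A i 0] is zero, and at s = K the exponent on [v] is negative.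
     The shift in [i] below works the same way. *)
  rewrite (_ : \sum_(s < K) _ = \sum_(s < K) (A i s)%:C *: G i s (t i s)); last first.
    rewrite -(@sum_ord_shift _ K (fun s => (A i s)%:C *: G i s (t i s))).
    - by apply: eq_bigr => s _; rewrite -(rmorphM (real_complex R)).
    - by rewrite /A scale0r.
    - rewrite /G /t (_ : _ - _ = Negz (i + K - N.+2)) ?mode0r ?scaler0 //; lia.
  over.
rewrite !big_split /=.
rewrite [X in _ + X + _](_ : _ = \sum_(i < K) \sum_(s < K) (B i s)%:C *: G i s (t i s)); last first.
  rewrite -(@sum_ord_shift _ K (fun i => \sum_(s < K) (B i s)%:C *: G i s (t i s))).
  - by apply: eq_bigr => i _; apply: eq_bigr => s _; rewrite mulrC -(rmorphM (real_complex R)).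
  - by apply: big1 => s _; rewrite /B scale0r.
  - apply: big1 => s _.
    rewrite /G /t (_ : _ - _ = Negz (s + K - N.+2)) ?mode0r ?scaler0 //; lia.
rewrite -!big_split scaler_sumr; apply: eq_bigr => i _ /=.
rewrite -!big_split scaler_sumr; apply: eq_bigr => s _ /=.
rewrite -!scalerDl scalerA; congr (_ *: _).
have E : A i s + B i s + expcoef x n i s * (t i s)%:~R = N.+1%:R * expcoef x n i s.
  rewrite -[A i s + B i s]expcoef_rec /t !intrD !mulrNz -!pmulrn natrD; ring.
rewrite -[N.+1%:R](rmorph_nat (real_complex R)) -!(rmorphM (real_complex R)).
by rewrite -!(rmorphD (real_complex R)) E.
Qed.

End ExpVir1.

Arguments divpow : simpl never.

(** * Moving e^{L_1} past a mode *)

Section ExpVir1Modes.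
Variables (R : realType) (V : conformalVA R).
Implicit Types (a b u v w : V).

Lemma mode_divpow_eq0 x y u v (n : int) (i s S : nat) (t : int) : hwt x u -> hwt y v ->
  x + y - 2 * n <= S%:Z -> (S <= s)%N ->
  mode (divpow i u) (n + s%:Z) (divpow t v) = 0.
Proof.
move=> xu yv xyS Ss; case: t => [t|t]; last by rewrite mode0r.
by apply: (hwt_mode0 (hwt_divpow i xu) (hwt_divpow t yv)); lia.
Qed.

Lemma mode_expD_eq0 x y u v (n : int) (i s S : nat) : hwt x u -> hwt y v ->
  x + y - 2 * n <= S%:Z -> (S <= s)%N ->
  mode (divpow i u) (n + s%:Z) (expD v) = 0.
Proof.
move=> xu yv xyS Ss; rewrite (expD_hwt yv (ltnSn _)) (semilin_sum (mode_is_linr _ _)).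
by apply: big1 => t _; exact: mode_divpow_eq0 yv xyS Ss.
Qed.

Lemma expD_mode x y u v (n : int) (S K : nat) : hwt x u -> hwt y v ->
  x + y - 2 * n <= S%:Z -> (`|x| + `|y| + S + 3 <= K)%N ->
  expD (mode u n v) = \sum_(i < K) \sum_(s < K)
    (expcoef R x n i s)%:C *: mode (divpow i u) (n + s%:Z) (expD v).
Proof.
move=> xu yv xyS leK.
rewrite (@expDE _ _ K); last first.
  by move=> j Kj; apply: (divpow_eq0 (hwt_mode n xu yv)); lia.
under eq_bigr => N _ do rewrite (divpow_mode n v xu (ltn_ord N)).
rewrite exchange_big; apply: eq_bigr => i _ /=.
rewrite exchange_big; apply: eq_bigr => s _ /=.
rewrite -scaler_sumr; congr (_ *: _).
(* Either [divpow i u] vanishes, or s >= S and the mode does, or K - (i+s) exceeds |y|, so that the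
   inner sum is the full exponential on [v]. The bound on [K] is chosen for the last case. *)
have [xi|ix] := ltnP `|x| i.
  have u0 : divpow i u = 0 by apply: (divpow_eq0 xu); lia.
  by rewrite u0 mode0l big1 // => N _; rewrite mode0l.
have [Ss|sS] := leqP S s.
  rewrite (mode_expD_eq0 i xu yv xyS Ss) big1 // => N _.
  exact: mode_divpow_eq0 yv xyS Ss.
rewrite -(semilin_sum (mode_is_linr _ _)); congr (mode _ _ _).
rewrite (@expD_hwt _ _ y v (K - (i + s))) //; last by lia.
rewrite -(big_mkord xpredT (fun N : nat => divpow (N%:Z - i%:Z - s%:Z) v)).
rewrite (big_cat_nat (n := i + s)) //=; last by lia.
rewrite big_nat_cond big1 ?add0r; last first.
  by move=> N /andP[/andP[_ NK] _]; rewrite (_ : _ - _ = Negz (i + s - N.+1)) //; lia.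
rewrite -{1}[(i + s)%N]add0n big_addn big_mkord; apply: eq_bigr => N _.
by congr (divpow _ v); lia.
Qed.

(** Terms are collected by l = j + s. The upper argument of the binomial in [expcoef] at (n + j, i,
    l - j) is free of [j], so Vandermonde sums them, and negation of the upper argument removes the
    sign (-1)^l. *)
Lemma expD_mode_sum x y u v (m : R) (n : int) (S K : nat) : hwt x u -> hwt y v ->
  x + y - 2 * n <= S%:Z -> (`|x| + `|y| + S + 3 <= K)%N ->
  \sum_(j < K) ((-1) ^+ j * rbin m j)%:C *: expD (mode u (n + j%:Z) v) =
  \sum_(i < K) \sum_(l < K)
    (rbin (x%:~R - 2 - m - i%:R - n%:~R) l)%:C *: mode (divpow i u) (n + l%:Z) (expD v).
Proof.
move=> xu yv xyS leK.
under eq_bigr => j _.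
  rewrite (@expD_mode x y u v (n + j%:Z) S K) //; last by lia.
  rewrite scaler_sumr.
  over.
rewrite exchange_big; apply: eq_bigr => i _ /=.
pose g (l : nat) := mode (divpow i u) (n + l%:Z) (expD v).
pose f (j s : nat) := ((-1) ^+ j * rbin m j * expcoef R x (n + j%:Z) i s)%:C *: g (j + s)%N.
transitivity (\sum_(j < K) \sum_(s < K) f j s).
  apply: eq_bigr => j _; rewrite scaler_sumr; apply: eq_bigr => s _.
  rewrite /f /g scalerA -(rmorphM (real_complex R)); congr (_ *: mode _ _ _); lia.
rewrite sum_triangle; last first.
  move=> j s Kjs; rewrite /f /g (mode_expD_eq0 i xu yv xyS) ?scaler0 //; lia.
apply: eq_bigr => l _.
transitivity (\sum_(j < l.+1)
    ((-1) ^+ j * rbin m j * expcoef R x (n + j%:Z) i (l - j))%:C *: g l).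
  by apply: eq_bigr => j _; rewrite /f subnKC // -ltnS.
rewrite -scaler_suml -(rmorph_sum (real_complex R)); congr (_%:C *: _).
have -> : x%:~R - 2 - m - i%:R - n%:~R =
    l%:R - 1 - (m + (i%:R + (n - x + 1)%:~R + l%:R)) :> R.
  by rewrite !(intrD, mulrNz); ring.
rewrite -rbin_upper_neg.
rewrite -rbin_Vandermonde mulr_sumr; apply: eq_bigr => j _.
have jl : (j <= l)%N by rewrite -ltnS.
rewrite /expcoef.
have -> : i%:R + (n + j%:Z - x + 1)%:~R + (l - j)%:R = i%:R + (n - x + 1)%:~R + l%:R :> R.
  by rewrite natrB // !(intrD, mulrNz) -!pmulrn; ring.
have -> : (-1) ^+ l = (-1) ^+ j * (-1) ^+ (l - j) :> R by rewrite -exprD subnKC.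
ring.
Qed.

End ExpVir1Modes.

(** * The phases exp(i t) *)

Section Expi.
Variable R : realType.
Implicit Types (s t : R).

Lemma expiD s t : expi (s + t) = expi s * expi t.
Proof. by rewrite /expi cosD sinD; simpc; rewrite [sin s * _ + _]addrC. Qed.

Lemma expi0 : expi (0 : R) = 1.
Proof. by rewrite /expi cos0 sin0. Qed.

Lemma expiN t : expi (- t) = (expi t)^*.
Proof. by rewrite /expi cosN sinN. Qed.

Lemma expi_pi : expi (pi : R) = -1.
Proof. by rewrite /expi cospi sinpi; apply/eqP; rewrite eq_complex /= oppr0 !eqxx. Qed.

Lemma expi_conjK t : expi t * (expi t)^* = 1.
Proof. by rewrite -expiN -expiD subrr expi0. Qed.

Lemma expi_piz (n : int) : expi (pi * n%:~R : R) = (-1) ^ n.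
Proof.
have H (k : nat) : expi (pi * k%:R : R) = (-1) ^+ k.
  elim: k => [|k IH]; first by rewrite mulr0 expi0.
  by rewrite -natr1 mulrDr mulr1 expiD IH expi_pi exprSr.
case: n => n; first exact: H.
rewrite NegzE mulrNz mulrN expiN -pmulrn H rmorphXn rmorphN rmorph1.
by rewrite -exprnN -exprVn invrN1.
Qed.

Lemma conj_real (x : R) : (x%:C)^* = x%:C :> R[i].
Proof. by apply/eqP; rewrite eq_complex /= oppr0 !eqxx. Qed.

End Expi.

(** * The map omega *)

Section Involution.
Variables (R : realType) (V : conformalVA R) (phi : V -> V).
Hypothesis Hphi : conj_involution phi.
Implicit Types (a b u v w : V).

Local Notation D := (vir (Lvec V) 1).
Local Notation conjR := (Num.conj : {rmorphism R[i] -> R[i]}).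

Lemma phi_semilin : semilin conjR phi.
Proof. by move=> c x y; exact: (phi_conj Hphi). Qed.

Lemma phi_vir n a : phi (vir (Lvec V) n a) = vir (Lvec V) n (phi a).
Proof. by rewrite /vir (phi_mode Hphi) (phi_L Hphi). Qed.

Lemma hwt_phi x a : hwt x a -> hwt x (phi a).
Proof.
rewrite /hwt => xa; rewrite -phi_vir xa (semilinZ phi_semilin) /=.
by rewrite fmorph_div rmorph_int rmorph_nat.
Qed.

Lemma par_vir n p a : par p a -> par p (vir (Lvec V) n a).
Proof. by move=> pa; rewrite -[p]addFb; apply: mode_par => //; exact: Lvec_even. Qed.

Lemma hwt_pcomp x p a : hwt x a -> hwt x (pcomp a p).
Proof.
rewrite /hwt => xa.
have <- : pcomp (vir (Lvec V) 0 a) p = vir (Lvec V) 0 (pcomp a p).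
  apply: (component_semilin (vir_is_lin 0)); try exact: par_direct.
  by move=> q b _; exact: par_vir.
by rewrite xa (semilinZ (pcomp_is_lin p)).
Qed.

Lemma hwt_par_ind (S : set V) : is_subspace S ->
  (forall (k : nat) p a, hwt k a -> par p a -> S a) -> forall a, S a.
Proof.
move=> sS H; apply: hwt_ind => // k a ka; rewrite [a]pcomp_sum.
by apply: subspaceD => //; apply: (H k) (pcomp_par _ _); exact: hwt_pcomp.
Qed.

Lemma pcomp_wcomp a k p : pcomp (wcomp a k) p = wcomp (pcomp a p) k.
Proof.
apply/esym/(component_semilin (pcomp_is_lin p)); try exact: weight_direct.
by move=> j c _; exact: (@hwt_pcomp j%:Z).
Qed.

Lemma par_wcomp p a k : par p a -> par p (wcomp a k).
Proof. by move=> pa; rewrite -(pcomp_id pa) -pcomp_wcomp; exact: pcomp_par. Qed.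

Lemma gmap_semilin : semilin conjR (gmap phi).
Proof.
move=> c a b; rewrite /gmap /=.
have fin v : finite_set [set k : nat | \sum_(p : bool)
    expi (- (pi * (k%:R / 2%:R + (p : nat)%:R / 2%:R))) *: phi (pcomp (wcomp v k) p) <> 0].
  apply: sub_finite_set (wcomp_finite v) => k /= nz k0; apply: nz.
  apply: big1 => p _.
  by rewrite k0 (semilin0 (pcomp_is_lin p)) (semilin0 phi_semilin) scaler0.
rewrite -(fsbig_lin _ _ (fin a) (fin b)).
apply: eq_fsbigr => k _.
rewrite scaler_sumr -big_split; apply: eq_bigr => p _ /=.
rewrite wcomp_is_lin pcomp_is_lin phi_semilin scalerDr !scalerA.
by rewrite [conjR c * _]mulrC.
Qed.

Definition gphase (x : int) (p : bool) : R[i] :=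
  expi (- (pi * (x%:~R / 2 + (p : nat)%:R / 2))).

Lemma gmap_hom x p a : hwt x a -> par p a -> gmap phi a = gphase x p *: phi a.
Proof.
case: x => k xa pa; last first.
  by rewrite (hwt_lt0 xa) // (semilin0 gmap_semilin) (semilin0 phi_semilin) scaler0.
rewrite /gmap (@fsum_one _ _ _ _ _ k) //; last first.
  move=> j _ jk; apply: big1 => q _; rewrite (wcomp_other xa).
    by rewrite (semilin0 (pcomp_is_lin q)) (semilin0 phi_semilin) scaler0.
  by apply: contra jk => /eqP[->].
rewrite (wcomp_same xa) (bigD1 p) //= big1 ?addr0 ?(pcomp_id pa) // => q qp.
by rewrite (pcomp_0 pa) // (semilin0 phi_semilin) scaler0.
Qed.

Lemma hwt_gmap x a : hwt x a -> hwt x (gmap phi a).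
Proof.
move=> xa; rewrite [a]pcomp_sum (semilinD gmap_semilin).
apply: subspaceD; first exact: hwt_subspace.
all: rewrite (gmap_hom (hwt_pcomp _ xa) (pcomp_par _ _)).
all: apply: subspaceZ; [exact: hwt_subspace | exact/hwt_phi/hwt_pcomp].
Qed.

Lemma par_gmap p a : par p a -> par p (gmap phi a).
Proof.
move=> pa; rewrite /gmap; apply: subspace_fsum => [|k _]; first exact: par_subspace.
apply: subspace_sum => [|q _]; first exact: par_subspace.
apply: subspaceZ; first exact: par_subspace.
have [->|qp] := eqVneq q p; first exact/(phi_par Hphi)/pcomp_par.
rewrite pcomp_wcomp (pcomp_0 pa qp) (semilin0 (wcomp_is_lin k)) (semilin0 phi_semilin).
exact: (par_subspace _ _).1.
Qed.

(** As [phi] is conjugate linear and keeps weight and parity, the second application contributes the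
    same phase times the conjugate of the first. *)
Lemma gmapK a : gmap phi (gmap phi a) = a.
Proof.
move: a; apply: hwt_par_ind.
  split=> [|c x y Hx Hy]; first by rewrite !(semilin0 gmap_semilin).
  by rewrite !gmap_semilin Hx Hy /= conjCK.
move=> k p a ka pa; rewrite (gmap_hom ka pa) (semilinZ gmap_semilin).
rewrite (gmap_hom (hwt_phi ka) (phi_par Hphi pa)) (phiK Hphi) scalerA.
by rewrite mulrC expi_conjK scale1r.
Qed.

(** The weight of a_(n) b is the sum of the weights minus n+1, which gives (-1)^(n+1); the parity is
    p + q - 2pq, which gives [psign]. *)
Lemma gmap_mode x y p q a b (n : int) :
  hwt x a -> hwt y b -> par p a -> par q b ->
  gmap phi (mode a n b) =
  ((-1) ^ (n + 1) * psign R p q) *: mode (gmap phi a) n (gmap phi b).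
Proof.
move=> xa yb pa qb.
rewrite (gmap_hom (hwt_mode n xa yb) (mode_par n pa qb)) (phi_mode Hphi).
rewrite (gmap_hom xa pa) (gmap_hom yb qb).
rewrite (semilinZ (mode_is_linl _ _)) (semilinZ (mode_is_linr _ _)) /= !scalerA.
congr (_ *: _); rewrite /psign -[(-1) ^+ _]/((-1) ^ ((p && q : nat) : int)).
rewrite -!expi_piz -!expiD; congr expi.
rewrite !(intrD, mulrNz, intrM) -!pmulrn.
by case: p pa => _; case: q qb => _ /=; field.
Qed.

(** Lowering the weight by one changes the phase by exp(i pi) = -1. *)
Lemma gmap_vir1 a : gmap phi (D a) = - D (gmap phi a).
Proof.
move: a; apply: hwt_par_ind.
  split=> [|c x y Hx Hy].
    by rewrite (semilin0 (vir_is_lin 1)) (semilin0 gmap_semilin)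
      (semilin0 (vir_is_lin 1)) oppr0.
  by rewrite vir_is_lin !gmap_semilin vir_is_lin Hx Hy opprD scalerN.
move=> k p a ka pa; rewrite (gmap_hom ka pa) (gmap_hom (hwt_vir1 ka) (par_vir 1 pa)).
rewrite phi_vir (semilinZ (vir_is_lin 1)) -scaleNr; congr (_ *: _).
have -> : - idfun (gphase k p) = expi (pi * 1%:~R) * gphase k p.
  by rewrite expi_piz expr1z mulN1r.
rewrite -expiD; congr expi.
by rewrite !(intrD, mulrNz) -!pmulrn; field.
Qed.

Lemma gmap_divpow (j : nat) a :
  gmap phi (divpow j a) = (-1) ^+ j *: divpow j (gmap phi a).
Proof.
rewrite /divpow (semilinZ gmap_semilin) /= fmorphV rmorph_nat.
rewrite scalerA mulrC -scalerA; congr (_ *: _).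
elim: j => [|j IH] /=; first by rewrite scale1r.
by rewrite gmap_vir1 IH (semilinZ (vir_is_lin 1)) exprS mulN1r scaleNr.
Qed.

Lemma divpow_divpow (i j : nat) a :
  divpow i (divpow j a) = 'C(i + j, i)%:R *: divpow (i + j)%N a.
Proof.
have iterL k : lin (iter k D).
  by elim: k => [|k IH] c x y //=; rewrite IH vir_is_lin.
rewrite /divpow (semilinZ (iterL i)) !scalerA -iterD; congr (_ *: _).
have := @bin_fact (i + j) i (leq_addr _ _); rewrite addKn => /(congr1 (fun z => z%:R : R[i])).
rewrite !natrM /= => <-.
have nz k : (k`!%:R : R[i]) != 0 by rewrite pnatr_eq0 -lt0n fact_gt0.
have bz : ('C(i + j, i)%:R : R[i]) != 0 by rewrite pnatr_eq0 -lt0n bin_gt0 leq_addr.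
by field; rewrite bz !nz.
Qed.

Lemma omegaE a : omega phi a = expD (gmap phi a).
Proof. by []. Qed.

Lemma omega_semilin : semilin conjR (omega phi).
Proof. by move=> c x y; rewrite !omegaE gmap_semilin expD_is_lin. Qed.

Lemma omega_hwt x a N : hwt x a -> (`|x| < N)%N ->
  omega phi a = \sum_(j < N) divpow j (gmap phi a).
Proof. by move=> xa xN; apply: (expD_hwt (hwt_gmap xa)). Qed.

(** Since g anticommutes with L_1 and squares to 1, the composite is e^{L_1} e^{-L_1}; its part of
    degree l > 0 is (1 - 1)^l times a divided power, by the binomial theorem. *)
Lemma omegaK a : omega phi (omega phi a) = a.
Proof.
move: a; apply: hwt_ind.
  split=> [|c x y Hx Hy]; first by rewrite !(semilin0 omega_semilin).
  by rewrite !omega_semilin Hx Hy /= conjCK.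
move=> k a ka; rewrite (omega_hwt ka (ltnSn _)) /=.
rewrite (semilin_sum omega_semilin).
have E (j : nat) : omega phi (divpow j (gmap phi a)) =
    \sum_(i < k.+1) (-1) ^+ j *: divpow i (divpow j a).
  rewrite omegaE gmap_divpow gmapK (semilinZ (@expD_is_lin _ V)) -scaler_sumr.
  congr (_ *: _); apply: expDE => i ki.
  by apply: (divpow_eq0 (hwt_divpow j ka)); lia.
under eq_bigr => j _ do rewrite E.
rewrite (@sum_triangle _ _ (fun j i => (-1) ^+ j *: divpow i%:Z (divpow j%:Z a))); last first.
  move=> j i kij; rewrite (divpow_eq0 (hwt_divpow j ka)) ?scaler0 //; lia.
rewrite big_ord_recl big_ord1 /= scale1r [X in _ + X]big1 => [|l _].
  by rewrite addr0 -[divpow _ (divpow _ a)]/(divpow 0 (divpow 0 a)) !divpow0.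
transitivity ((1 - 1 : R[i]) ^+ l.+1 *: divpow l.+1 a).
  rewrite exprDn scaler_suml; apply: eq_bigr => j _.
  have jl : (j <= l.+1)%N by rewrite -ltnS.
  rewrite divpow_divpow subnK // expr1n mul1r scalerA bin_sub //.
  by rewrite mulr_natr.
by rewrite subrr expr0n scale0r.
Qed.

(** The sign (-1)^(n+j+1) of [gmap_mode] supplies the alternating factor (-1)^j that [expD_mode_sum]
    requires. *)
Lemma omega_mode_sum x y p q a b (m : R) (n : int) (S K : nat) :
  hwt x a -> hwt y b -> par p a -> par q b ->
  x + y - 2 * n <= S%:Z -> (`|x| + `|y| + S + 3 <= K)%N ->
  omega phi (\sum_(j < K) (rbin m j)%:C *: mode a (n + j%:Z) b) =
  ((-1) ^ (n + 1) * psign R p q) *: \sum_(i < K) \sum_(l < K)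
    (rbin (x%:~R - 2 - m - i%:R - n%:~R) l)%:C *:
      mode (divpow i (gmap phi a)) (n + l%:Z) (omega phi b).
Proof.
move=> xa yb pa qb xyS leK.
rewrite -(expD_mode_sum m (hwt_gmap xa) (hwt_gmap yb) xyS leK).
rewrite (semilin_sum omega_semilin) scaler_sumr; apply: eq_bigr => j _.
rewrite (semilinZ omega_semilin) /= omegaE (gmap_mode (n + j%:Z) xa yb pa qb).
rewrite (semilinZ (@expD_is_lin _ V)) /= conj_real !scalerA; congr (_ *: _).
have -> : ((-1) ^+ j * rbin m j)%:C = (-1) ^+ j * (rbin m j)%:C :> R[i].
  by rewrite (rmorphM _ ((-1) ^+ j)) (rmorphXn _ j (-1)) rmorphN1.
rewrite addrAC expfzDr ?oppr_eq0 ?oner_eq0 //.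
by rewrite -[(-1) ^ j%:Z]/((-1) ^+ j); ring.
Qed.

End Involution.

(** * The grading, and L in V^[0] *)

Section Grading.
Variables (R : realType) (Gam : set R) (V : conformalVA R) (phi : V -> V).
Variable Ups : R -> set V.
Hypothesis HGam : Gam = @int_set R \/ Gam = @half_int_set R.
Hypothesis Hphi : conj_involution phi.
Hypothesis HUps : is_grading Gam Ups.
Hypothesis Hcompat : compatible_grading Gam Ups phi.
Implicit Types (a b u v w : V).

Local Notation D := (vir (Lvec V) 1).

Lemma int_setN (x : R) : int_set x -> int_set (- x).
Proof. by move=> [n ->]; exists (- n); rewrite mulrNz. Qed.

Lemma int_setD (x y : R) : int_set x -> int_set y -> int_set (x + y).
Proof. by move=> [n ->] [m ->]; exists (n + m); rewrite intrD. Qed.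

Lemma int_setB (x y : R) : int_set x -> int_set y -> int_set (x - y).
Proof. by move=> ix /int_setN; exact: int_setD. Qed.

Lemma int_set_int (n : int) : int_set (n%:~R : R).
Proof. by exists n. Qed.

Lemma cosetZE (x y : R) : cosetZ x y <-> int_set (y - x).
Proof.
split=> [[n ->]|[n E]]; exists n; first by rewrite addrC addKr.
by rewrite -E addrC subrK.
Qed.

Lemma Gam_int (n : int) : Gam n%:~R.
Proof.
case: HGam => ->; first by exists n.
by exists (n * 2); rewrite intrM mulfK // pnatr_eq0.
Qed.

Lemma Gam0 : Gam 0.
Proof. exact: (Gam_int 0). Qed.

Lemma GamD g h : Gam g -> Gam h -> Gam (g + h).
Proof.
case: HGam => -> [n ->] [m ->]; exists (n + m); first by rewrite intrD.
by rewrite intrD mulrDl.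
Qed.

(** Each coset is its own opposite. Hence the adjoint of a mode allowed on V^[g] is again a mode
    allowed on V^[g]. *)
Lemma Gam_double g : Gam g -> int_set (g + g).
Proof.
case: HGam => -> [n ->]; first by exists (n + n); rewrite intrD.
by exists n; rewrite -splitr.
Qed.

Local Notation idx := [set g | Gam g /\ 0 <= g < 1].

Lemma Ups_shift g h : int_set (g - h) -> Ups g = Ups h.
Proof. by move=> [n E]; rewrite -(Ups_periodic HUps h n) -E addrC subrK. Qed.

Lemma Ups_repr g : Gam g -> exists g', [/\ idx g', Ups g' = Ups g & int_set (g' - g)].
Proof.
move=> Gg; exists (g + (- Num.floor g)%:~R); split.
- split; first by apply: GamD => //; exact: Gam_int.
  have /andP[h1 h2] := floor_itv g.
  by rewrite mulrNz subr_ge0 h1 /= ltrBlDl; move: h2; rewrite intrD.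
- exact: (Ups_periodic HUps).
- by rewrite addrC addKr; exact: int_set_int.
Qed.

Lemma Ups_subspace g : Gam g -> is_subspace (Ups g).
Proof. by move=> /Ups_repr[g' [ig' <- _]]; exact: ((Ups_direct HUps).1 g'). Qed.

Lemma Ups_disjoint g h v : Gam g -> Gam h -> ~ int_set (g - h) ->
  Ups g v -> Ups h v -> v = 0.
Proof.
move=> Gg Gh gh; have [g' [ig' <- gg']] := Ups_repr Gg.
have [h' [ih' <- hh']] := Ups_repr Gh => vg vh.
rewrite -(component_same (Ups_direct HUps) ig' vg).
apply: (component_other (Ups_direct HUps) ih' vh).
apply/eqP => E; apply: gh.
have -> : g - h = (h' - h) - (g' - g) by rewrite E; ring.
exact: int_setB.
Qed.

Definition ucomp (v : V) (g : R) : V := component idx Ups v g.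

Lemma ucomp_is_lin g : lin (fun v => ucomp v g).
Proof. exact: (component_is_lin (Ups_direct HUps)). Qed.

Lemma ucomp_commute (f : V -> V) v g : lin f ->
  (forall h x, Gam h -> Ups h x -> Ups h (f x)) -> ucomp (f v) g = f (ucomp v g).
Proof.
move=> fL fU; apply: (component_semilin fL); try exact: (Ups_direct HUps).
by move=> h x [Gh _]; exact: fU.
Qed.

Lemma hwt_ucomp x v g : hwt x v -> hwt x (ucomp v g).
Proof.
rewrite /hwt => xv.
rewrite -(ucomp_commute _ _ (vir_is_lin 0)); last exact: (Ups_L0 HUps).
by rewrite xv (semilinZ (ucomp_is_lin g)).
Qed.

Lemma par_ucomp p v g : par p v -> par p (ucomp v g).
Proof.
move=> pv; rewrite -(pcomp_id pv) (ucomp_commute _ _ (pcomp_is_lin p)).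
  exact: pcomp_par.
by move=> h x Gh hx; exact: (Ups_par HUps).
Qed.

(** L_0 respects the grading, so [ucomp] preserves weight spaces and the two projections commute. *)
Lemma Ups_wcomp g v k : Gam g -> Ups g v -> Ups g (wcomp v k).
Proof.
move=> Gg; have [g' [ig' <- _]] := Ups_repr Gg => gv.
rewrite -(component_same (Ups_direct HUps) ig' gv) -/(ucomp v g').
have -> : wcomp (ucomp v g') k = ucomp (wcomp v k) g'.
  apply: (component_semilin (ucomp_is_lin g')); try exact: weight_direct.
  by move=> j x _; exact: (@hwt_ucomp j%:Z).
exact: (component_in (Ups_direct HUps)).
Qed.

Definition hom (g : R) (x : int) (p : bool) (a : V) : Prop :=
  [/\ Gam g, Ups g a, hwt x a & par p a].

Lemma Ups_ind (S : set V) : is_subspace S ->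
  (forall g a, Gam g -> Ups g a -> S a) -> forall a, S a.
Proof.
by move=> sS H; apply: (component_ind (Ups_direct HUps)) => // g a [Gg _]; exact: H.
Qed.

Lemma hom_ind (S : set V) : is_subspace S ->
  (forall g (k : nat) p a, hom g k p a -> S a) -> forall a, S a.
Proof.
move=> sS H; apply: Ups_ind => // g a Gg ga.
rewrite [a]pcomp_sum; apply: subspaceD => //.
all: rewrite [pcomp a _]wcomp_sum; apply: subspace_fsum => // k _; apply: (H g k).
all: split; first by [].
- by apply: Ups_wcomp => //; exact: (Ups_par HUps).
- exact: wcomp_hwt.
- exact/par_wcomp/pcomp_par.
- by apply: Ups_wcomp => //; exact: (Ups_par HUps).
- exact: wcomp_hwt.
- exact/par_wcomp/pcomp_par.
Qed.

Lemma max_nonpos_int (t : R) : max_nonpos t = 0 <-> int_set t.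
Proof.
rewrite /max_nonpos; split=> [/eqP|[n ->]]; first by rewrite subr_eq0 => /eqP ->; exists (Num.ceil t).
by rewrite intrKceil subrr.
Qed.

Lemma hwt0_mode v (n : int) : hwt 0 v -> n != - 1 -> mode v n (vac V) = 0.
Proof.
move=> v0 n1; have : weight_of (Lvec V) 0 v by exact: v0.
rewrite weight0 => -[c ->].
by rewrite (semilinZ (mode_is_linl _ _)) vac_mode (negbTE n1) scaler0.
Qed.

(** A generator has g - k/2 integral; for weight one (k = 2) this makes [g] an integer. It serves to
    place L_1 of the degree-zero part of L in V^[0]. *)
Lemma zhuV_weight1 v : zhuV Gam Ups v -> Ups 0 (wcomp v 2).
Proof.
move=> Zv; have := Zv [set x | Ups 0 (wcomp x 2)]; apply.
  split=> [|c x y] /=.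
    by rewrite (semilin0 (wcomp_is_lin 2)); exact: (Ups_subspace Gam0).1.
  by rewrite wcomp_is_lin; exact: (Ups_subspace Gam0).2.
move=> a [g [k [[Gg ga ka] /max_nonpos_int gk]]] /=.
have [k2|k2] := eqVneq k 2.
  rewrite -[X in Ups X]subr0 (@Ups_shift _ g); last first.
    have -> : 0 - 0 - g = - (g - k%:R / 2%:R + 1%:~R) :> R.
      by rewrite k2 divff ?pnatr_eq0 //; ring.
    apply: int_setN; apply: int_setD => //; exact: int_set_int.
  exact: Ups_wcomp.
rewrite (@wcomp_other _ _ k%:Z) //; first exact: (Ups_subspace Gam0).1.
by apply/eqP; move/eqP: k2; lia.
Qed.

Hypothesis Homega : forall a : V, zhuV Gam Ups a -> zhuV Gam Ups (omega phi a).

Lemma Lvec_split : exists L0 l : V, [/\ Lvec V = L0 + l, hom 0 4 false L0,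
  hwt 4 l, par false l & l = 0 \/ Gam (2^-1) /\ Ups (2^-1) l].
Proof.
pose L := Lvec V; have L4 : hwt 4 L by exact: Lvec_weight.
have Lev : par false L by exact: Lvec_even.
exists (ucomp L 0), (L - ucomp L 0).
have i0 : idx 0 by split; [exact: Gam0 | rewrite lexx ltr01].
split.
- by rewrite addrC subrK.
- split; [exact: Gam0 | exact: (component_in (Ups_direct HUps)) |
          exact: hwt_ucomp | exact: par_ucomp].
- apply: subspaceB => //; [exact: hwt_subspace | exact: hwt_ucomp].
- apply: subspaceB => //; [exact: par_subspace | exact: par_ucomp].
case: HGam => HG.
  left; apply/eqP; rewrite subr_eq0; apply/eqP.
  rewrite {1}(component_sum (Ups_direct HUps) L) (@fsum_one _ _ _ _ _ 0) //.
  move=> j [+ j01]; rewrite HG => -[n nj] /eqP[]; move: j01; rewrite nj.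
  by rewrite ler0z -[1]/(1%:~R) ltr_int => n01; have -> : n = 0 by lia.
right; have Gh : Gam (2^-1) by rewrite HG; exists 1; rewrite mul1r.
split=> //; have H : forall v, Ups 2^-1 (v - ucomp v 0); last exact: H.
apply: (component_ind (Ups_direct HUps)).
  split=> [|c x y Hx Hy].
    by rewrite (semilin0 (ucomp_is_lin 0)) subrr; exact: (Ups_subspace Gh).1.
  rewrite ucomp_is_lin opprD addrACA -scalerBr; exact: (Ups_subspace Gh).2.
move=> g v ig gv; case: (ig) => + g01; rewrite HG => -[n gn].
have [n0|n0] := eqVneq n 0.
  rewrite n0 mul0r in gn; rewrite gn in gv.
  rewrite /ucomp (component_same (Ups_direct HUps) i0 gv) subrr.
  exact: (Ups_subspace Gh).1.
have n1 : n = 1.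
  have /andP[] : (0 <= n%:~R :> R) && (n%:~R < 2%:~R :> R) by move: g01; rewrite gn; lra.
  by rewrite ler0z ltr_int; lia.
rewrite /ucomp (component_other (Ups_direct HUps) ig gv) ?subr0.
  by move: gv; rewrite gn n1 mul1r.
by rewrite gn n1 mul1r eq_sym invr_eq0 pnatr_eq0.
Qed.

Lemma Lvec_Ups0 : Ups 0 (Lvec V).
Proof.
have [L0 [l [LE [_ L0U L04 L0p] l4 lp [l0|[Gh lU]]]]] := Lvec_split.
  by rewrite LE l0 addr0.
pose h : R := 2^-1; rewrite -/h in Gh lU.
have hh : int_set (h + h) by exact: Gam_double.
have nh : ~ int_set h.
  move=> [n /(congr1 ( *%R 2))]; rewrite /h divff ?pnatr_eq0 // -[1]/(1%:~R) -[2]/(2%:~R) -intrM => /eqP.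
  by rewrite eqr_int => /eqP; lia.
have disj g v : Gam g -> Ups g v -> Ups (h + g) v -> v = 0.
  move=> Gg gv hv; apply: (Ups_disjoint (GamD Gh Gg) Gg _ hv gv).
  by rewrite addrK.
have disj0 v : Ups 0 v -> Ups h v -> v = 0.
  by move=> v0 vh; apply: (disj 0 _ Gam0) => //; rewrite addr0.
have Lm n v : mode (Lvec V) n v = mode L0 n v + mode l n v.
  by rewrite LE (semilinD (mode_is_linl _ _)).
(* On V^[g] the operator l_(1) has values in V^[g+1/2]; as the difference of L_0 and the mode (1) of
   the other summand it also has values in V^[g]. *)
have l1 v : mode l 1 v = 0.
  move: v; apply: Ups_ind.
    by split=> [|c x y Hx Hy]; rewrite ?mode0r // mode_linr Hx Hy scaler0 addr0.
  move=> g v Gg gv; apply: (disj g) => //; last exact: (Ups_mode HUps).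
  have -> : mode l 1 v = mode (Lvec V) 1 v - mode L0 1 v by rewrite Lm addrC addKr.
  apply: (subspaceB (Ups_subspace Gg)); first exact: (Ups_L0 HUps).
  by rewrite -[g]add0r; apply: (Ups_mode HUps) => //; exact: Gam0.
(* The witness [phi L0] has weight 2 and lies in V^[0], hence in V_Upsilon. The phase of weight 2
   being 1, g sends it to [L0], and the weight-one part of e^{L_1} [L0] is L_1 [L0]. *)
have DL0 : Ups 0 (D L0).
  have Z : zhuV Gam Ups (omega phi (phi L0)).
    apply: Homega => U _; apply; exists 0, 4%N; split.
      split; [exact: Gam0 | exact: (Hcompat Gam0) | exact: (@hwt_phi _ _ _ Hphi 4)].
    apply/max_nonpos_int; exists (- 2); rewrite sub0r mulrNz; congr (- _).
    by rewrite (natrM _ 2 2) mulfK // pnatr_eq0.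
  have gL : gmap phi (phi L0) = L0.
    rewrite (gmap_hom Hphi (hwt_phi Hphi L04) (phi_par Hphi L0p)) (phiK Hphi).
    have -> : gphase R 4 false = 1; last by rewrite scale1r.
    rewrite /gphase [X in expi X](_ : _ = pi * (- 2)%:~R).
      by rewrite expi_piz -[LHS]/(((-1) ^+ 2)^-1) sqrrN expr1n invr1.
    by rewrite mulrNz -[4%:~R]/(4%:R : R) -[2%:~R]/(2%:R : R) /=; field.
  have := zhuV_weight1 Z.
  rewrite (omega_hwt Hphi (hwt_phi Hphi L04) (ltnSn _)) gL.
  rewrite (semilin_sum (wcomp_is_lin 2)) (bigD1 (Ordinal (isT : 1 < 5)%N)) //= big1 ?addr0.
    by rewrite wcomp_same ?divpow1 //; exact: (hwt_vir1 L04).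
  move=> j j1; apply: (wcomp_other (hwt_divpow j L04)).
  by apply: contra j1 => /eqP E; apply/eqP/val_inj => /=; lia.
have l2L0 : mode l 2 L0 = 0.
  apply: disj0; last by rewrite -[h]addr0; apply: (Ups_mode HUps) => //; exact: Gam0.
  have -> : mode l 2 L0 = D L0 - mode L0 2 L0 by rewrite /vir Lm addrC addKr.
  apply: (subspaceB (Ups_subspace Gam0)) => //.
  by rewrite -[X in Ups X]addr0; apply: (Ups_mode HUps) => //; exact: Gam0.
(* L is L_(-2) applied to the vacuum, and [L_1, L_(-2)] = 3 T kills the vacuum, as does L_1. *)
have DL : D (Lvec V) = 0.
  have [c /(_ 1 (- 2) (vac V))] := @virasoro _ V.
  rewrite vir_transl transl_vac /= !scaler0 scale0r add0r.
  have -> : D (vac V) = 0 by exact: mode_vac0.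
  have -> : vir (Lvec V) (- 2) (vac V) = Lvec V by exact: mode_vac.
  by rewrite (semilin0 (vir_is_lin _)) subr0.
(* Skew-symmetry gives l_(2) l = - l_(2) l: the first correction comes from l_(3) l, a multiple of
   the vacuum, and the later ones from vectors of negative weight. *)
have l2l : mode l 2 l = 0.
  have H : mode l 2 l = - mode l 2 l.
    rewrite {1}(skew_symmetry1 lp lp).
      by rewrite -[(-1) ^ 2]/((-1) ^+ 2) sqrrN expr1n scaleN1r.
    case=> // j _; have l4j := hwt_mode (2 + j.+1%:Z) l4 l4.
    case: j l4j => [|j] l4j; last by rewrite (hwt_lt0 l4j) ?mode0l //; lia.
    by rewrite hwt0_mode.
  have : 2%:R *: mode l 2 l = 0 by rewrite scaler_nat mulr2n {1}H addNr.
  by move=> /eqP; rewrite scaler_eq0 pnatr_eq0 => /eqP.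
(* Expanding L_1 L = 0 bilinearly leaves this vector, of V^[1/2], equal to minus a vector of
   V^[0]. *)
have L0l : mode L0 2 l = 0.
  apply: disj0; last by rewrite -[h]add0r; apply: (Ups_mode HUps) => //; exact: Gam0.
  have -> : mode L0 2 l = - mode L0 2 L0.
    move: DL; rewrite /vir LE (semilinD (mode_is_linr _ _)) -LE !Lm l2L0 l2l !addr0.
    by move/eqP; rewrite addrC addr_eq0 => /eqP.
  rewrite -scaleN1r; apply: (subspaceZ _ (Ups_subspace Gam0)).
  by rewrite -[X in Ups X]addr0; apply: (Ups_mode HUps) => //; exact: Gam0.
have Dl : D l = 0 by rewrite /vir Lm L0l l2l addr0.
have : mode l 1 (Lvec V) = 2%:R *: l.
  rewrite (skew_symmetry1 (@Lvec_even _ V) lp).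
    have -> : mode (Lvec V) 1 l = 2%:R *: l.
      by rewrite -[LHS]/(vir (Lvec V) 0 l) l4 -[4%:~R]/((2 * 2)%:R) natrM mulfK // pnatr_eq0.
    by rewrite expr1z opprK scale1r.
  case=> // j _; case: j => [|j].
    by rewrite -[mode _ (1 + _) l]/(D l) Dl mode0l.
  have l4j := hwt_mode (1 + j.+2%:Z) (@Lvec_weight _ V : hwt 4 _) l4.
  case: j l4j => [|j] l4j; last by rewrite (hwt_lt0 l4j) ?mode0l //; lia.
  by rewrite hwt0_mode.
rewrite l1 => /esym/eqP; rewrite scaler_eq0 pnatr_eq0 /= => /eqP l0.
by rewrite LE l0 addr0.
Qed.

Lemma Ups_vir g n a : Gam g -> Ups g a -> Ups g (vir (Lvec V) n a).
Proof.
move=> Gg ga; rewrite -[g]add0r; apply: (Ups_mode HUps) => //; first exact: Gam0.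
exact: Lvec_Ups0.
Qed.

(** This uses [Lvec_Ups0]. Thanks to it each term of omega(a) is homogeneous, and the twisted
    Borcherds identity applies to it. *)
Lemma hom_divpow g x p a (j : nat) : hom g x p a -> hom g (x - 2 * j%:Z) p (divpow j a).
Proof.
move=> [Gg ga xa pa]; split=> //; last 2 first.
- exact: hwt_divpow.
- rewrite /divpow; apply: (subspaceZ _ (par_subspace _ _)); elim: j => //= j; exact: par_vir.
rewrite /divpow; apply: (subspaceZ _ (Ups_subspace Gg)); elim: j => //= j; exact: Ups_vir.
Qed.

Lemma hom_gmap g x p a : hom g x p a -> hom g x p (gmap phi a).
Proof.
move=> [Gg ga xa pa]; split=> //; [|exact: hwt_gmap|exact: par_gmap].
rewrite (gmap_hom Hphi xa pa); apply: (subspaceZ _ (Ups_subspace Gg)); exact: Hcompat.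
Qed.

End Grading.

(** * Modes on a twisted module *)

Section TwistedModule.
Variables (R : realType) (Gam : set R) (V : conformalVA R) (phi : V -> V).
Variables (Ups : R -> set V) (M : twistedModule Gam Ups).
Hypothesis HGam : Gam = @int_set R \/ Gam = @half_int_set R.
Hypothesis Hphi : conj_involution phi.
Hypothesis HUps : is_grading Gam Ups.
Hypothesis Hcompat : compatible_grading Gam Ups phi.
Hypothesis Homega : forall a : V, zhuV Gam Ups a -> zhuV Gam Ups (omega phi a).
Implicit Types (a b c u w : V) (v : M).

Local Notation homV := (hom Gam Ups).

Lemma tmode_is_linl m v : lin (fun a => @tmode _ _ _ _ M a m v).
Proof. by move=> c x y; exact: tmode_linl. Qed.

Lemma tmode_is_linr a m : lin (@tmode _ _ _ _ M a m).
Proof. by move=> c x y; exact: tmode_linr. Qed.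

(* The operator a^M_n. *)
Definition smode (a : V) (n : R) (v : M) : M :=
  \sum_(k \in [set: nat]) tmode (wcomp a k) (n + k%:R / 2 - 1) v.

Lemma zero_modeE a v : zero_mode a v = smode a 0 v.
Proof. by apply: eq_fsbigr => k _; rewrite add0r. Qed.

Lemma smode_finite a n v :
  finite_set [set k : nat | tmode (wcomp a k) (n + k%:R / 2 - 1) v <> 0].
Proof.
apply: sub_finite_set (wcomp_finite a) => k /= nz k0; apply: nz.
by rewrite k0 (semilin0 (tmode_is_linl _ _)).
Qed.

Lemma smode_is_linl n v : lin (fun a => smode a n v).
Proof.
move=> c a b; rewrite -(fsbig_lin _ _ (smode_finite a n v) (smode_finite b n v)).
by apply: eq_fsbigr => k _; rewrite wcomp_is_lin tmode_is_linl.
Qed.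

Lemma smode_is_linr a n : lin (smode a n).
Proof.
move=> c u v; rewrite -(fsbig_lin _ _ (smode_finite a n u) (smode_finite a n v)).
by apply: eq_fsbigr => k _; rewrite tmode_is_linr.
Qed.

Lemma smode_suml (K : nat) (f : 'I_K -> V) n v :
  smode (\sum_(i < K) f i) n v = \sum_(i < K) smode (f i) n v.
Proof. exact: (semilin_sum (smode_is_linl n v)). Qed.

Lemma smode_sumr a n (K : nat) (f : 'I_K -> M) :
  smode a n (\sum_(i < K) f i) = \sum_(i < K) smode a n (f i).
Proof. exact: (semilin_sum (smode_is_linr a n)). Qed.

Lemma smodeE x a n v : hwt x a -> smode a n v = tmode a (n + x%:~R / 2 - 1) v.
Proof.
case: x => k xa; last first.
  rewrite (hwt_lt0 xa) // (semilin0 (tmode_is_linl _ _)).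
  exact: (semilin0 (smode_is_linl n v)).
rewrite /smode (@fsum_one _ _ _ _ _ k) // ?(wcomp_same xa) //.
move=> j _ jk; by rewrite (wcomp_other xa) ?(semilin0 (tmode_is_linl _ _)).
Qed.

(* a_n vanishes on M for a in V^[g] of weight x/2 unless this holds. *)
Definition adm (g : R) (x : int) (n : R) : Prop := int_set (n + x%:~R / 2 - g).

Lemma adm_tmode g x n : adm g x n -> cosetZ g (n + x%:~R / 2 - 1).
Proof.
move=> H; apply/cosetZE; rewrite addrAC; apply: int_setB => //; exact: (int_set_int _ 1).
Qed.

(** The two defining quantities add up to x - 2g - i, an integer by [Gam_double]. *)
Lemma adm_opp g x n (i : nat) : Gam g -> adm g x n -> adm g (x - 2 * i%:Z) (- n).
Proof.
move=> Gg H; rewrite /adm.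
have -> : - n + (x - 2 * i%:Z)%:~R / 2 - g =
    x%:~R - (g + g) - i%:~R - (n + x%:~R / 2 - g).
  by rewrite intrD mulrNz intrM; field.
apply: int_setB => //; apply: int_setB; last exact: int_set_int.
by apply: int_setB; [exact: int_set_int | exact: Gam_double HGam _ Gg].
Qed.

Lemma adm_oppE g x n (i : nat) : Gam g -> adm g (x - 2 * i%:Z) (- n) -> adm g x n.
Proof.
move=> Gg H; rewrite /adm.
have -> : n + x%:~R / 2 - g =
    x%:~R - (g + g) - i%:~R - (- n + (x - 2 * i%:Z)%:~R / 2 - g).
  by rewrite intrD mulrNz intrM; field.
apply: int_setB => //; apply: int_setB; last exact: int_set_int.
by apply: int_setB; [exact: int_set_int | exact: Gam_double HGam _ Gg].
Qed.

Lemma smode_supp g x p a n v : homV g x p a -> ~ adm g x n -> smode a n v = 0.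
Proof.
move=> [Gg ga xa _] nadm; rewrite (smodeE _ _ xa); apply: (tmode_supp _ Gg ga) => H.
apply: nadm; move: H => /cosetZE H; rewrite /adm.
have -> : n + x%:~R / 2 - g = (n + x%:~R / 2 - 1 - g) + 1%:~R by ring.
by apply: int_setD => //; exact: int_set_int.
Qed.

(** The substitution m = s + x/2 - 1, k = t + y/2 - 1 gives every term the same degree s + t + n. *)
Lemma smode_borcherds g h x y p q a b (n : int) (s t : R) v :
  homV g x p a -> homV h y q b -> adm g x s -> adm h y t ->
  \sum_(j \in [set: nat])
    gbin (s + x%:~R / 2 - 1) j *: smode (mode a (n + j%:Z) b) (s + t + n%:~R) v =
  \sum_(j \in [set: nat])
    ((-1) ^+ j * gbin n%:~R j) *:
      (smode a (s + n%:~R - j%:R) (smode b (t + j%:R) v) -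
       (psign R p q * (-1) ^ n) *:
          smode b (t + n%:~R - j%:R) (smode a (s + j%:R) v)).
Proof.
move=> [Gg ga xa pa] [Gh hb yb qb] sg th.
have := tborcherds n v Gg Gh pa qb ga hb (adm_tmode sg) (adm_tmode th).
congr (_ = _); apply: eq_fsbigr => j _.
  rewrite (smodeE _ _ (hwt_mode _ xa yb)); congr (_ *: tmode _ _ _).
  by rewrite !(intrD, mulrNz, intrM) -!pmulrn; field.
congr (_ *: (_ - _ *: _)); rewrite (smodeE _ _ xa) (smodeE _ _ yb).
  by congr (tmode _ _ (tmode _ _ _)); ring.
by congr (tmode _ _ (tmode _ _ _)); ring.
Qed.

Lemma smode_comm g h x y p q a b n k v (K : nat) :
  homV g x p a -> homV h y q b -> adm g x n -> adm h y k ->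
  (forall j, (K <= j)%N -> mode a j%:Z b = 0) ->
  smode a n (smode b k v) - psign R p q *: smode b k (smode a n v) =
  \sum_(j < K) (rbin (n + x%:~R / 2 - 1) j)%:C *: smode (mode a j%:Z b) (n + k) v.
Proof.
move=> ha hb an bk Kab; have E := smode_borcherds 0 v ha hb an bk.
rewrite [RHS](@fsum_nat _ _ _ 1) in E; last first.
  move=> j j0; rewrite gbinE mulr0z -[0]/(0%:R) rbin_nat_gt //.
  by rewrite mulr0 scale0r.
rewrite big_ord1 /= gbinE mulr0z rbin0 expr0 mulr1 scale1r expr0z mulr1 in E.
rewrite !(addr0, subr0) in E; rewrite -{}E.
rewrite (@fsum_nat _ _ _ K).
  by apply: eq_bigr => j _; rewrite add0r.
by move=> j /Kab Ej; rewrite add0r Ej (semilin0 (smode_is_linl _ _)) scaler0.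
Qed.

Lemma omega_divpow x b : hwt x b ->
  omega phi b = \sum_(i < `|x|.+1) divpow i (gmap phi b).
Proof. by move=> xb; exact: (omega_hwt Hphi xb (ltnSn _)). Qed.

Lemma smode_omega_supp g x p a n v : homV g x p a -> ~ adm g x n ->
  smode (omega phi a) (- n) v = 0.
Proof.
move=> ha nadm; have [Gg _ xa _] := ha.
rewrite (omega_divpow xa) smode_suml.
apply: big1 => i _.
apply: (smode_supp _ (hom_divpow HGam Hphi HUps Hcompat Homega i
  (hom_gmap HGam Hphi HUps Hcompat ha))).
by move=> /(adm_oppE Gg).
Qed.

(* [a_n, b_k] = c_{n+k} for a vector c of V that does not depend on the
   module, and omega reverses this commutator. *)
Lemma comm_adjoint g h x y p q a b n k : homV g x p a -> homV h y q b ->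
  exists c, forall v : M,
    smode a n (smode b k v) - psign R p q *: smode b k (smode a n v) =
      smode c (n + k) v /\
    smode (omega phi b) (- k) (smode (omega phi a) (- n) v) -
      psign R p q *: smode (omega phi a) (- n) (smode (omega phi b) (- k) v) =
      smode (omega phi c) (- (n + k)) v.
Proof.
move=> ha hb; have [Gg ga xa pa] := ha; have [Gh hb' yb qb] := hb.
have om0 : omega phi (0 : V) = 0 by exact: (semilin0 (omega_semilin Hphi)).
(* If a degree is not admissible, the modes and their adjoints vanish and c = 0 serves. *)
have [an|an] := pselect (adm g x n); last first.
  exists 0 => v; rewrite om0 !(semilin0 (smode_is_linl _ _)).
  rewrite !(smode_supp _ ha an) !(smode_omega_supp _ ha an).
  by rewrite !(semilin0 (smode_is_linr _ _)) !scaler0 !subr0.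
have [bk|bk] := pselect (adm h y k); last first.
  exists 0 => v; rewrite om0 !(semilin0 (smode_is_linl _ _)).
  rewrite !(smode_supp _ hb bk) !(smode_omega_supp _ hb bk).
  by rewrite !(semilin0 (smode_is_linr _ _)) !scaler0 !subr0.
pose S := (`|x| + `|y|)%N; pose K := (`|x| + `|y| + S + 3)%N.
pose m := n + x%:~R / 2 - 1.
exists (\sum_(j < K) (rbin m j)%:C *: mode a (0 + j%:Z) b) => v; split.
  rewrite (@smode_comm _ _ _ _ _ _ _ _ _ _ _ K ha hb an bk); last first.
    by move=> j Kj; apply: (hwt_mode0 xa yb); lia.
  rewrite smode_suml; apply: eq_bigr => j _.
  by rewrite add0r (semilinZ (smode_is_linl _ _)).
rewrite (omega_mode_sum Hphi _ xa yb pa qb (S := S)) //; last by lia.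
rewrite add0r expr1z mulN1r (semilinZ (smode_is_linl _ _)) /=.
set u := gmap phi a; set w := omega phi b.
have hu i := hom_divpow HGam Hphi HUps Hcompat Homega i (hom_gmap HGam Hphi HUps Hcompat ha).
have hw i := hom_divpow HGam Hphi HUps Hcompat Homega i (hom_gmap HGam Hphi HUps Hcompat hb).
(* With m = n + x/2 - 1 the upper argument equals -n + (x - 2i)/2 - 1, the one in the commutator
   formula for [divpow i u] in degree -n. *)
have comm_i (i : nat) : \sum_(l < K) (rbin (x%:~R - 2 - m - i%:R - 0%:~R) l)%:C *:
      smode (mode (divpow i u) (0 + l%:Z) w) (- (n + k)) v =
    smode (divpow i u) (- n) (smode w (- k) v) -
    psign R p q *: smode w (- k) (smode (divpow i u) (- n) v).
  rewrite /w (omega_divpow yb) !smode_suml.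
  rewrite smode_sumr scaler_sumr -sumrB.
  under [RHS]eq_bigr => i' _.
    rewrite (@smode_comm _ _ _ _ _ _ _ _ _ _ _ K
      (hu i) (hw i') (adm_opp i Gg an) (adm_opp i' Gh bk)).
      over.
    move=> j Kj; apply: (hwt_mode0 (hwt_divpow i (hwt_gmap Hphi xa))
      (hwt_divpow i' (hwt_gmap Hphi yb))).
    by lia.
  rewrite exchange_big; apply: eq_bigr => l _ /=.
  rewrite (semilin_sum (mode_is_linr _ _)) smode_suml.
  rewrite scaler_sumr; apply: eq_bigr => i' _.
  rewrite add0r -opprD; congr ((rbin _ l)%:C *: _).
  by rewrite /m !(intrD, mulrNz, intrM) -!pmulrn; field.
rewrite smode_suml.
under [X in _ = _ *: X]eq_bigr => i _.
  rewrite smode_suml.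
  under eq_bigr => l _ do rewrite (semilinZ (smode_is_linl _ _)) /=.
  rewrite comm_i.
  over.
have E1 z : \sum_(i < K) smode (divpow i u) (- n) z = smode (omega phi a) (- n) z.
  rewrite -smode_suml; congr smode.
  by apply/esym; apply: (omega_hwt Hphi xa); rewrite /K; lia.
have E2 : \sum_(i < K) psign R p q *: smode w (- k) (smode (divpow i u) (- n) v) =
    psign R p q *: smode w (- k) (smode (omega phi a) (- n) v).
  by rewrite -scaler_sumr -E1 smode_sumr.
rewrite sumrB E1 E2.
(* The prefactor of [omega_mode_sum] at n = 0 is minus [psign]; it exchanges the roles of the two
   products. *)
have ps : psign R p q * psign R p q = 1 by rewrite -expr2 sqrr_sign.
by rewrite scalerBr scalerA mulNr ps scaleN1r opprK addrC scaleNr.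
Qed.

End TwistedModule.

(** * The action of J on M_0 *)

Section PositiveEnergy.
Variables (R : realType) (Gam : set R) (V : conformalVA R) (phi : V -> V).
Variables (Ups : R -> set V) (M : twistedModule Gam Ups) (Mgr : R -> set M).
Hypothesis HGam : Gam = @int_set R \/ Gam = @half_int_set R.
Hypothesis Hphi : conj_involution phi.
Hypothesis HUps : is_grading Gam Ups.
Hypothesis Hcompat : compatible_grading Gam Ups phi.
Hypothesis Homega : forall a : V, zhuV Gam Ups a -> zhuV Gam Ups (omega phi a).
Hypothesis HM : positive_energy Mgr.
Implicit Types (a b c u w : V) (v : M).

Local Notation homV := (hom Gam Ups).

Lemma Mgr_subspace j : is_subspace (Mgr j).
Proof.
have [j0|j0] := ltP j 0; last exact: ((Mgr_direct HM).1 j).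
by rewrite (Mgr_neg HM j0); split=> [//|c x y -> ->]; rewrite scaler0 addr0.
Qed.

Lemma smode_degree a n j v : Mgr j v -> Mgr (j - n) (smode a n v).
Proof.
move=> jv; move: a; apply: (hom_ind HGam HUps).
  split=> [|c x y /= Hx Hy].
    by rewrite (semilin0 (smode_is_linl _ _)); exact: (Mgr_subspace _).1.
  by rewrite smode_is_linl; apply: (Mgr_subspace _).2.
move=> g k p a ha; have [an|an] := pselect (adm g k n); last first.
  by rewrite (smode_supp _ ha an); exact: (Mgr_subspace _).1.
have [Gg ga ka _] := ha; rewrite (smodeE _ _ ka).
apply: (Mgr_mode HM Gg ga ka) => //; apply/cosetZE.
by rewrite opprB addrA.
Qed.

Lemma smode_lowering a n v : 0 < n -> Mgr 0 v -> smode a n v = 0.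
Proof.
move=> n0 /(smode_degree a n); rewrite sub0r (Mgr_neg HM) //.
by rewrite oppr_lt0.
Qed.

(** On the right of the Borcherds identity each product first applies a mode of degree t + j or s +
    j, both positive, to a vector of M_0. *)
Lemma smode_product_min g h x y p q a b (n : int) (s t : R) (K : nat) v :
  homV g x p a -> homV h y q b -> adm g x s -> adm h y t ->
  0 < s -> 0 < t -> s + t + n%:~R = 0 -> Mgr 0 v ->
  (forall j, (K <= j)%N -> mode a (n + j%:Z) b = 0) ->
  \sum_(j < K) (rbin (s + x%:~R / 2 - 1) j)%:C *: smode (mode a (n + j%:Z) b) 0 v = 0.
Proof.
move=> ha hb sg th s0 t0 st v0 Kab.
have := smode_borcherds n v ha hb sg th.
rewrite st (@fsum_nat _ _ _ K) => [->|]; last first.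
  by move=> j /Kab ->; rewrite (semilin0 (smode_is_linl _ _)) scaler0.
apply: fsbig1 => j _.
rewrite (@smode_lowering b (t + j%:R)) ?ltr_pwDl // (@smode_lowering a (s + j%:R)) ?ltr_pwDl //.
by rewrite !(semilin0 (smode_is_linr _ _)) scaler0 subrr scaler0.
Qed.

Lemma epsE (g : R) (k : nat) : eps g k = g - k%:R / 2 - (Num.ceil (g - k%:R / 2))%:~R.
Proof. by []. Qed.

Lemma eps_gtN1 (g : R) k : -1 < eps g k.
Proof.
rewrite epsE; have := ceil_itv (g - k%:R / 2) => /andP[]; rewrite intrD; lra.
Qed.

Lemma eps_le0 (g : R) k : eps g k <= 0.
Proof. by rewrite epsE subr_le0 ceil_ge. Qed.

(** Both claims are instances of [smode_product_min]: the generator with degrees (s, t), its image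
    under omega with (t, s). *)
Lemma zhu_generator_act g h (k l : nat) a b v : homog Gam Ups g k a ->
  homog Gam Ups h l b -> int_set (eps g k + eps h l) -> Mgr 0 v ->
  let x := \sum_(j \in [set: nat])
    gbin (gam g k) j *: mode a (- 2 + chi g k h l + j%:Z) b in
  smode x 0 v = 0 /\ smode (omega phi x) 0 v = 0.
Proof.
move=> [Gg ga ka] [Gh hb lb] kl v0 /=.
set n : int := - 2 + chi g k h l; pose S := (k + l + 2 * `|n|)%N.
pose K := (k + l + S + 3)%N.
pose J a b := \sum_(j < K) (rbin (gam g k) j)%:C *: mode a (n + j%:Z) b.
rewrite (@fsum_nat _ _ _ K); last first.
  by move=> j Kj; rewrite (hwt_mode0 (ka : hwt k a) (lb : hwt l b)) ?scaler0 //; lia.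
rewrite -/(J a b).
(* This [s] turns the upper argument s + k/2 - 1 into [gam g k], and [t] is forced by s + t + n = 0,
   that is t = 1 - chi - eps_a. If chi = 1, then eps_b > -1 forces eps_a < 0, so t > 0 in both
   cases. *)
pose s := eps g k + 1; pose t := - n%:~R - s.
have sE : s + k%:Z%:~R / 2 - 1 = gam g k by rewrite /s /gam; ring.
have s0 : 0 < s by rewrite /s; have := eps_gtN1 g k; lra.
have t0 : 0 < t.
  have := eps_gtN1 h l; have := eps_le0 g k; rewrite /t /s /n /chi.
  by case: ifP => [|_]; rewrite intrD mulrNz; lra.
have st : s + t + n%:~R = 0 by rewrite /t; ring.
have ad1 : adm g k s.
  rewrite /adm /s epsE -[k%:Z%:~R]/(k%:R).
  have -> : forall c : R, g - k%:R / 2 - c + 1 + k%:R / 2 - g = 1%:~R - c by move=> c; ring.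
  by apply: int_setB; exact: int_set_int.
have ad2 : adm h l t.
  rewrite /adm -[l%:Z%:~R]/(l%:R).
  have -> : t + l%:R / 2 - h = - (n + 1)%:~R - (eps g k + eps h l)
      - (Num.ceil (h - l%:R / 2))%:~R.
    by rewrite /t /s (epsE h l) intrD; ring.
  apply: int_setB; last exact: int_set_int.
  by apply: int_setB => //; apply: int_setN; exact: int_set_int.
(* The exchanged degrees are admissible too, by [Gam_double]. *)
have add2 : adm g k t.
  have := ad1; rewrite /adm; have -> : t + k%:Z%:~R / 2 - g =
    k%:Z%:~R - (g + g) - n%:~R - (s + k%:Z%:~R / 2 - g) by rewrite /t; field.
  move=> ?; apply: int_setB => //; apply: int_setB; last exact: int_set_int.
  by apply: int_setB; [exact: int_set_int | exact: (Gam_double HGam)].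
have add1 : adm h l s.
  have := ad2; rewrite /adm; have -> : s + l%:Z%:~R / 2 - h =
    l%:Z%:~R - (h + h) - n%:~R - (t + l%:Z%:~R / 2 - h) by rewrite /t; field.
  move=> ?; apply: int_setB => //; apply: int_setB; last exact: int_set_int.
  by apply: int_setB; [exact: int_set_int | exact: (Gam_double HGam)].
have JD1 u u' b' : J (u + u') b' = J u b' + J u' b'.
  by rewrite -big_split; apply: eq_bigr => j _; rewrite (semilinD (mode_is_linl _ _)) scalerDr.
have JD2 u b' b'' : J u (b' + b'') = J u b' + J u b''.
  by rewrite -big_split; apply: eq_bigr => j _; rewrite (semilinD (mode_is_linr _ _)) scalerDr.
have omD := semilinD (omega_semilin Hphi); have smD := semilinD (smode_is_linl 0 v).
suff H p q u w : homV g k p u -> homV h l q w ->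
    smode (J u w) 0 v = 0 /\ smode (omega phi (J u w)) 0 v = 0.
  have hp p : homV g k p (pcomp a p).
    by split=> //; [exact: (Ups_par HUps) | exact: hwt_pcomp | exact: pcomp_par].
  have hq q : homV h l q (pcomp b q).
    by split=> //; [exact: (Ups_par HUps) | exact: hwt_pcomp | exact: pcomp_par].
  rewrite [a]pcomp_sum [b]pcomp_sum JD1 !JD2 !omD !smD.
  have H' p q := H p q _ _ (hp p) (hq q).
  by split; [rewrite !(H' _ _).1 | rewrite !(H' _ _).2]; rewrite !addr0.
move=> hu hw; have [_ _ ku pu] := hu; have [_ _ lw qw] := hw; split.
  rewrite /J smode_suml -[RHS](smode_product_min (K := K) hu hw ad1 ad2 s0 t0 st v0); last first.
    by move=> j Kj; apply: (hwt_mode0 ku lw); lia.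
  apply: eq_bigr => j _; rewrite (semilinZ (smode_is_linl _ _)) /=.
  by rewrite sE.
rewrite /J (omega_mode_sum Hphi _ ku lw pu qw (S := S)) //; last 1 first.
- by rewrite /S; lia.
rewrite (semilinZ (smode_is_linl _ _)) smode_suml big1 ?scaler0 // => i _.
have hi := hom_divpow HGam Hphi HUps Hcompat Homega i (hom_gmap HGam Hphi HUps Hcompat hu).
have hi' (i' : nat) := hom_divpow HGam Hphi HUps Hcompat Homega i'
  (hom_gmap HGam Hphi HUps Hcompat hw).
have [_ _ kui _] := hi.
rewrite smode_suml (omega_divpow Hphi lw).
(* The upper argument k - 2 - gam - i - n of [omega_mode_sum] is the one belonging to degree [t] and
   the weight of the i-th divided power. *)
transitivity (\sum_(i' < `|l|.+1) \sum_(j < K) (rbin (t + (k%:Z - 2 * i%:Z)%:~R / 2 - 1) j)%:C *: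
   smode (mode (divpow i (gmap phi u)) (n + j%:Z) (divpow i' (gmap phi w))) 0 v).
  rewrite exchange_big; apply: eq_bigr => j _ /=.
  rewrite (semilinZ (smode_is_linl _ _)) (semilin_sum (mode_is_linr _ _)) smode_suml.
  rewrite scaler_sumr; apply: eq_bigr => i' _; congr ((rbin _ _)%:C *: _).
  by rewrite /t /s /gam !(intrD, mulrNz, intrM) -!pmulrn; field.
apply: big1 => i' _.
have [_ _ lwi _] := hi' i'.
apply: (smode_product_min (s := t) (t := s) hi (hi' i')) => //.
- have := add2; rewrite /adm.
  have -> : t + (k%:Z - 2 * i%:Z)%:~R / 2 - g = t + k%:Z%:~R / 2 - g - i%:Z%:~R.
    by rewrite intrD mulrNz intrM; field.
  by move=> ?; apply: int_setB => //; exact: int_set_int.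
- have := add1; rewrite /adm.
  have -> : s + (l%:Z - 2 * i'%:Z)%:~R / 2 - h = s + l%:Z%:~R / 2 - h - i'%:Z%:~R.
    by rewrite intrD mulrNz intrM; field.
  by move=> ?; apply: int_setB => //; exact: int_set_int.
- by rewrite [t + s]addrC.
- by move=> j Kj; apply: (hwt_mode0 kui lwi); lia.
Qed.

Lemma zhuJ_act x v : zhuJ Gam Ups x -> Mgr 0 v ->
  smode x 0 v = 0 /\ smode (omega phi x) 0 v = 0.
Proof.
move=> Jx v0; apply: (Jx [set x | smode x 0 v = 0 /\ smode (omega phi x) 0 v = 0]).
  split=> [|c y z [y1 y2] [z1 z2]] /=.
    by rewrite (semilin0 (omega_semilin Hphi)) (semilin0 (smode_is_linl 0 v)).
  by rewrite (omega_semilin Hphi) !smode_is_linl y1 y2 z1 z2 !scaler0 !addr0.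
move=> y [g [k [h [l [a [b [ha hb int ->]]]]]]].
exact: zhu_generator_act.
Qed.

End PositiveEnergy.

(** * Invariance in terms of modes *)

Section Invariance.
Variables (R : realType) (Gam : set R) (V : conformalVA R) (phi : V -> V).
Variables (Ups : R -> set V) (M : twistedModule Gam Ups).
Hypothesis Hphi : conj_involution phi.
Implicit Types (a b c u w : V) (v : M).

Local Notation conjR := (Num.conj : {rmorphism R[i] -> R[i]}).

Lemma Acoef_hwt (k : nat) a (d : int) : hwt k a ->
  Acoef phi a d = divpow (d + k%:Z) (gmap phi a).
Proof.
move=> ka; have ku := hwt_gmap Hphi ka; rewrite /Acoef.
have z (jl : nat * nat) : jl.2 != k ->
    divpow jl.1 (wcomp (gmap phi a) jl.2) = 0.
  move=> lk; rewrite (wcomp_other ku) ?(semilin0 (@divpow_is_lin _ V _)) //.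
case E : (d + k%:Z) => [m|m].
  rewrite (@fsum_one _ _ _ _ _ (m, k)) /= ?(wcomp_same ku) //; first by lia.
  move=> [j l] /= jl ne; apply: (z (j, l)) => /=.
  by apply: contra ne => /eqP lk; apply/eqP; congr (_, _); lia.
apply: fsbig1 => -[j l] /= jl; apply: (z (j, l)) => /=.
by apply/eqP; lia.
Qed.

(** Each factor L_1 lowers the weight by one and raises the power of z by one, so all terms of A(z)a
    contribute in the same degree e + k/2. *)
Lemma YAcoef_hwt (k : nat) a e v : hwt k a ->
  YAcoef phi a e v = smode (omega phi a) (e + k%:R / 2) v.
Proof.
move=> ka; have ku := hwt_gmap Hphi ka.
rewrite (omega_divpow Hphi ka) /= smode_suml /YAcoef.
pose f (j : nat) : int := j%:Z - k%:Z.
(* Only the exponents d = j - k with 0 <= j <= k can occur in A(z)a. *)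
rewrite (fsum_conv (A := f @` `I_k.+1)) //; last first.
  move=> d _ nd; rewrite (Acoef_hwt _ ka).
  case E : (d + k%:Z) => [m|m]; last by rewrite (semilin0 (tmode_is_linl _ _)).
  rewrite (divpow_eq0 ku) ?(semilin0 (tmode_is_linl _ _)) //.
  rewrite ltNge; apply/negP => km; apply: nd; exists m; rewrite /f /=; lia.
rewrite fsbig_image; last by move=> i j _ _; rewrite /f => ?; lia.
rewrite -fsbig_ord; apply: eq_bigr => j _.
rewrite (Acoef_hwt _ ka) (_ : f j + k%:Z = j%:Z); last by rewrite /f; lia.
rewrite (smodeE _ _ (hwt_divpow j ku)); congr (tmode _ _ _).
by rewrite /f !(intrD, mulrNz, intrM) -!pmulrn; field.
Qed.

Lemma wcomp_bound a : exists K : nat, forall l, (K <= l)%N -> wcomp a l = 0.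
Proof.
move: a; apply: hwt_ind.
  split=> [|c x y [N HN] [P HP]].
    by exists 0 => l _; rewrite (semilin0 (wcomp_is_lin l)).
  exists (maxn N P) => l; rewrite geq_max => /andP[Nl Pl].
  by rewrite wcomp_is_lin HN // HP // scaler0 addr0.
move=> k a ka; exists k.+1 => l kl; apply: (wcomp_other ka).
by apply/eqP; lia.
Qed.

(** Finiteness of the support is what makes the sums in [Acoef] and [YAcoef] additive in [a]. *)
Lemma Acoef_support a : exists K : nat, forall j l : nat,
  divpow j (wcomp (gmap phi a) l) <> 0 -> (j < K)%N /\ (l < K)%N.
Proof.
have [K HK] := wcomp_bound (gmap phi a); exists K => j l nz.
have lK : (l < K)%N.
  rewrite ltnNge; apply/negP => /HK l0; apply: nz.
  by rewrite l0 (semilin0 (@divpow_is_lin _ V _)).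
split=> //; rewrite ltnNge; apply/negP => Kj; apply: nz.
by apply: (divpow_eq0 (wcomp_hwt _ _)); lia.
Qed.

Lemma Acoef_semilin d : semilin conjR (fun a => Acoef phi a d).
Proof.
move=> c a b.
have fin x : finite_set [set jl : nat * nat |
    divpow jl.1 (wcomp (gmap phi x) jl.2) <> 0].
  have [K HK] := Acoef_support x.
  apply: (@sub_finite_set _ _ (`I_K `*` `I_K)); last exact: finite_setX.
  by move=> [j l] /= /HK.
rewrite /Acoef -(fsbig_lin _ _ (fin a) (fin b)); apply: eq_fsbigr => jl _.
by rewrite (gmap_semilin Hphi) wcomp_is_lin -[LHS]/(divpow jl.1 _) divpow_is_lin.
Qed.

Lemma YAcoef_semilin e v : semilin conjR (fun a => YAcoef phi a e v).
Proof.
move=> c a b.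
have fin x : finite_set [set d : int | tmode (Acoef phi x d) (e - d%:~R - 1) v <> 0].
  have [K HK] := Acoef_support x.
  apply: (@sub_finite_set _ _ ((fun m : nat => m%:Z - K%:Z) @` `I_(K + K))); last first.
    exact/finite_image/finite_II.
  move=> d /= nz; apply: contrapT => nd; apply: nz.
  rewrite (_ : Acoef _ _ _ = 0) ?(semilin0 (tmode_is_linl _ _)) //.
  apply: fsbig1 => -[j l] /= jl; apply: contrapT => /(HK j l)[jK lK].
  by apply: nd; exists (absz (d + K%:Z)) => /=; lia.
rewrite /YAcoef -(fsbig_lin _ _ (fin a) (fin b)); apply: eq_fsbigr => d _.
by rewrite Acoef_semilin tmode_is_linl.
Qed.

Section Form.
Variable B : M -> M -> R[i].
Hypothesis HB : hermitian_form B.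

Lemma form_linr x : semilin idfun (B x : M -> R[i]^o).
Proof. by case: HB => _ H _ c y z; exact: H. Qed.

Lemma form_linl y : semilin conjR ((fun x => B x y) : M -> R[i]^o).
Proof. by case: HB => H _ _ c x z; exact: H. Qed.

Definition mode_invariant : Prop := forall a n m1 m2,
  B m1 (smode a n m2) = B (smode (omega phi a) (- n) m1) m2.

(** For [a] of weight k/2 the exponent [e] and the degree [n] determine each other by n = -(e +
    k/2); semilinearity reduces both sides to such [a]. *)
Lemma phi_invariantE : phi_invariant phi B <-> mode_invariant.
Proof.
split=> H a.
  move=> n m1 m2; move: a; apply: hwt_ind.
    split=> [|c x y /= Hx Hy].
      rewrite (semilin0 (omega_semilin Hphi)) !(semilin0 (smode_is_linl _ _)).
      by rewrite (semilin0 (form_linr _)) (semilin0 (form_linl _)).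
    rewrite (omega_semilin Hphi) !smode_is_linl form_linr form_linl Hx Hy /=.
    by rewrite conjCK.
  move=> k a ka; have := H a m1 m2 (- n - k%:R / 2).
  rewrite (YAcoef_hwt _ _ ka) subrK (smodeE _ _ ka) => <-.
  by rewrite opprB opprK [n + _]addrC.
move=> m1 m2 e; move: a; apply: hwt_ind.
  split=> [|c x y /= Hx Hy].
    rewrite (semilin0 (tmode_is_linl _ _)) (semilin0 (YAcoef_semilin _ _)).
    by rewrite (semilin0 (form_linr _)) (semilin0 (form_linl _)).
  rewrite tmode_is_linl YAcoef_semilin form_linr form_linl Hx Hy /=.
  by rewrite conjCK.
move=> k a ka; have := H a (- (e + k%:R / 2)) m1 m2.
rewrite (YAcoef_hwt _ _ ka) opprK (smodeE _ _ ka) => <-.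
by congr (B _ (tmode _ _ _)); rewrite -[k%:Z%:~R]/(k%:R); ring.
Qed.

End Form.
End Invariance.

(** * Words in the modes *)

Section Words.
Variables (R : realType) (Gam : set R) (V : conformalVA R) (phi : V -> V).
Variables (Ups : R -> set V) (M : twistedModule Gam Ups).
Hypothesis HGam : Gam = @int_set R \/ Gam = @half_int_set R.
Hypothesis HUps : is_grading Gam Ups.

Local Notation letter := (V * R)%type.
Local Notation homV := (hom Gam Ups).

Definition word_act (w : seq letter) (v : M) : M :=
  foldr (fun l v => smode l.1 l.2 v) v w.

(** A left fold, because adjoints reverse the order: the letter that [word_act] applies last has its
    adjoint applied first. *)
Definition word_adj (w : seq letter) (v : M) : M :=
  foldl (fun v l => smode (omega phi l.1) (- l.2) v) v w.

Lemma word_act_cons l w v : word_act (l :: w) v = smode l.1 l.2 (word_act w v).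
Proof. by []. Qed.

Lemma word_adj_cons l w v :
  word_adj (l :: w) v = word_adj w (smode (omega phi l.1) (- l.2) v).
Proof. by []. Qed.

Lemma word_act_cat w1 w2 v : word_act (w1 ++ w2) v = word_act w1 (word_act w2 v).
Proof. exact: foldr_cat. Qed.

Lemma word_adj_cat w1 w2 v : word_adj (w1 ++ w2) v = word_adj w2 (word_adj w1 v).
Proof. exact: foldl_cat. Qed.

Lemma word_act_is_lin w : lin (word_act w).
Proof.
by elim: w => [|l w IH] c x y //; rewrite !word_act_cons IH smode_is_linr.
Qed.

Lemma word_adj_is_lin w : lin (word_adj w).
Proof.
by elim: w => [|l w IH] c x y //; rewrite !word_adj_cons smode_is_linr IH.
Qed.

(* A product a_n b_k ... of modes applied to M_0 is reduced by pushing a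
   rightmost raising mode to the left; each transposition costs a shorter word. *)
Lemma word_ind (P : seq letter -> Prop) :
  P [::] ->
  (forall w b k, 0 < k -> P (rcons w (b, k))) ->
  (forall w b, P w -> P (rcons w (b, 0))) ->
  (forall w b k, k < 0 -> P ((b, k) :: w)) ->
  (forall w1 w2 n, is_subspace [set a | P (w1 ++ (a, n) :: w2)]) ->
  (forall w1 w2 g h x y p q a b n k, homV g x p a -> homV h y q b ->
     (forall c, P (w1 ++ (c, n + k) :: w2)) -> P (w1 ++ (b, k) :: (a, n) :: w2) ->
     P (w1 ++ (a, n) :: (b, k) :: w2)) ->
  forall w, P w.
Proof.
move=> P0 Plow Pzero Praise Plin Pswap.
suff H : forall N w, (size w <= N)%N -> P w by move=> w; exact: (H (size w)).
elim=> [|N IH]; first by case.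
(* The raising letter travels through [w1] from right to left. Each swap needs homogeneous letters,
   obtained by linearity, and leaves a word of size at most [N]. *)
have left w1 : forall w2 b k, k < 0 -> (size w1 + size w2 <= N)%N -> P (w1 ++ (b, k) :: w2).
  elim/last_ind: w1 => [|w1 [a n] IHw] w2 b k k0 szN; first exact: Praise.
  rewrite size_rcons in szN.
  move: b; apply: (hom_ind HGam HUps); first exact: Plin.
  move=> h l q b hb /=; rewrite cat_rcons.
  move: a; apply: (hom_ind HGam HUps); first exact: Plin.
  move=> g x p a ha /=; apply: (Pswap _ _ _ _ _ _ _ _ _ _ _ _ ha hb) => [c|].
    by apply: IH; rewrite size_cat addnS -addSn.
  by apply: IHw => //=; rewrite addnS -addSn.
move=> w; elim/last_ind: w => // w [b k] _; rewrite size_rcons => szN.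
have [k0|k0|->] := ltgtP k 0; last by apply: Pzero; exact: IH.
  by rewrite -cats1; apply: left => //; rewrite addn0.
exact: Plow.
Qed.

End Words.

(** * Extension of forms from M_0 *)

Section Extension.
Variables (R : realType) (Gam : set R) (V : conformalVA R) (phi : V -> V).
Variables (Ups : R -> set V) (M : twistedModule Gam Ups) (Mgr : R -> set M).
Hypothesis HGam : Gam = @int_set R \/ Gam = @half_int_set R.
Hypothesis Hphi : conj_involution phi.
Hypothesis HUps : is_grading Gam Ups.
Hypothesis Hcompat : compatible_grading Gam Ups phi.
Hypothesis Homega : forall a : V, zhuV Gam Ups a -> zhuV Gam Ups (omega phi a).
Hypothesis HM : positive_energy Mgr.
Hypothesis Hgen : generated_by (Mgr 0).
Implicit Types (a : V).

Local Notation conjR := (Num.conj : {rmorphism R[i] -> R[i]}).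
Local Notation adj := (word_adj phi).

Lemma smode_gen (U : set M) : is_subspace U -> Mgr 0 `<=` U ->
  (forall a n v, U v -> U (smode a n v)) -> forall v, U v.
Proof.
move=> sU U0 Us; suff -> : U = setT by [].
apply: Hgen => // a m v Uv; move: a; apply: hwt_ind.
  split=> [|c x y /= Hx Hy]; first by rewrite (semilin0 (tmode_is_linl _ _)); exact: sU.1.
  by rewrite tmode_is_linl; exact: sU.2.
move=> k a ka; have := Us a (m + 1 - k%:R / 2) v Uv.
by rewrite (smodeE _ _ ka) -[k%:Z%:~R]/(k%:R) subrK addrK.
Qed.

(** [U] itself need not be stable under modes; the least subspace containing all words applied to
    M_0 is, so it is all of M. *)
Lemma word_gen (U : set M) : is_subspace U ->
  (forall w v, Mgr 0 v -> U (word_act w v)) -> forall v, U v.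
Proof.
move=> sU Uw v.
suff H : forall x : M, [set x | forall T : set M, is_subspace T ->
    (forall w v, Mgr 0 v -> T (word_act w v)) -> T x] x by exact: H.
move=> {}v; apply: smode_gen.
- split=> [T sT _|c x y Hx Hy T sT Tw]; first exact: sT.1.
  by apply: sT.2; [exact: Hx | exact: Hy].
- by move=> x x0 T sT /(_ [::] x x0).
move=> a n x Hx T sT Tw; apply: (Hx [set x | T (smode a n x)]).
  split=> [|c y z /= Hy Hz]; first by rewrite /= (semilin0 (smode_is_linr _ _)); exact: sT.1.
  by rewrite smode_is_linr; exact: sT.2.
by move=> w y y0 /=; exact: (Tw ((a, n) :: w)).
Qed.

Definition proj0 (v : M) : M := component [set j : R | 0 <= j] Mgr v 0.

Lemma proj0_is_lin : lin proj0.
Proof. exact: (component_is_lin (Mgr_direct HM)). Qed.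

Lemma proj0_in v : Mgr 0 (proj0 v).
Proof. by apply: (component_in (Mgr_direct HM)) => /=. Qed.

Lemma proj0_id v : Mgr 0 v -> proj0 v = v.
Proof. by apply: (component_same (Mgr_direct HM)) => /=. Qed.

Lemma proj0_eq0 j v : Mgr j v -> j != 0 -> proj0 v = 0.
Proof.
move=> jv j0; have [jn|jp] := ltP j 0.
  by move: jv; rewrite (Mgr_neg HM jn) => ->; exact: (semilin0 proj0_is_lin).
by apply: (component_other (Mgr_direct HM) jp jv); rewrite eq_sym.
Qed.

(** A component in M_0 would have to come from degree j = n < 0, where M is zero. *)
Lemma proj0_raising j a n v : Mgr j v -> n < 0 -> proj0 (smode a n v) = 0.
Proof.
move=> jv n0; have djv := smode_degree HGam HUps HM a n jv.
have [jn|jn] := eqVneq (j - n) 0; last exact: proj0_eq0 djv jn.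
have j0 : j < 0 by rewrite (_ : j = n) //; apply/eqP; rewrite -subr_eq0 jn.
move: jv; rewrite (Mgr_neg HM j0) => ->.
by rewrite (semilin0 (smode_is_linr _ _)) (semilin0 proj0_is_lin).
Qed.

Lemma proj0_smode0 j a v : Mgr j v -> proj0 (smode a 0 v) = smode a 0 (proj0 v).
Proof.
move=> jv; have := smode_degree HGam HUps HM a 0 jv; rewrite subr0 => djv.
have [j0|j0] := eqVneq j 0; first by rewrite j0 in jv djv; rewrite !proj0_id.
by rewrite !(proj0_eq0 _ j0) // (semilin0 (smode_is_linr _ _)).
Qed.

Lemma word_act_degree w j v : Mgr j v -> exists i, Mgr i (word_act w v).
Proof.
move=> jv; elim: w => [|[a n] w [i Hi]]; first by exists j.
by exists (i - n); exact: smode_degree.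
Qed.

Lemma word_adj_degree w j v : Mgr j v -> exists i, Mgr i (adj w v).
Proof.
elim: w j v => [|[a n] w IH] j v jv; first by exists j.
exact: IH (smode_degree HGam HUps HM _ _ jv).
Qed.

Lemma psign_conj p q : (psign R p q)^* = psign R p q.
Proof. by rewrite /psign rmorphXn rmorphN rmorph1. Qed.

(* A form on M_0, extended to M by zero on the other M_j. *)
Variable b : M -> M -> R[i].
Hypothesis Hb : hermitian_form b.
Hypothesis b_proj : forall x y, b x y = b (proj0 x) (proj0 y).
Hypothesis b_zero : forall a x y, Mgr 0 x -> Mgr 0 y ->
  b x (smode a 0 y) = b (smode (omega phi a) 0 x) y.

Let bZr := form_linr Hb.
Let bZl := form_linl Hb.

(** By [word_ind]. With a lowering letter on the right or a raising one on the left, both sides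
    vanish, since the adjoint raises or lowers respectively; zero modes are covered by [b_zero],
    swaps by [comm_adjoint]. *)
Lemma word_adjoint w x y : Mgr 0 x -> Mgr 0 y ->
  b x (word_act w y) = b (adj w x) y.
Proof.
pose P w := forall x y, Mgr 0 x -> Mgr 0 y -> b x (word_act w y) = b (adj w x) y.
suff : P w by apply.
have om := omega_semilin Hphi.
move: w {x y}; apply: (word_ind HGam HUps) => //.
- move=> w c k k0 x y x0 y0; rewrite -cats1 word_act_cat word_adj_cat /=.
  rewrite (smode_lowering HGam HUps HM c k0 y0) (semilin0 (word_act_is_lin w)).
  rewrite (semilin0 (bZr _)) b_proj.
  have [j Hj] := word_adj_degree w x0.
  by rewrite (proj0_raising _ Hj) ?oppr_lt0 // (semilin0 (bZl _)).
- move=> w c IH x y x0 y0; rewrite -cats1 word_act_cat word_adj_cat /=.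
  have cy0 : Mgr 0 (smode c 0 y).
    by rewrite -[X in Mgr X]subr0; exact: smode_degree.
  rewrite IH // b_proj (proj0_id cy0) b_zero //; last exact: proj0_in.
  have [j Hj] := word_adj_degree w x0.
  by rewrite oppr0 -(proj0_smode0 _ Hj) -{1}(proj0_id y0) -b_proj.
- move=> w c k k0 x y x0 y0; rewrite word_act_cons word_adj_cons /=.
  have [j Hj] := word_act_degree w y0.
  rewrite b_proj (proj0_raising _ Hj) // (semilin0 (bZr _)).
  rewrite (smode_lowering HGam HUps HM) ?oppr_gt0 //.
  by rewrite (semilin0 (word_adj_is_lin _ _)) (semilin0 (bZl _)).
- move=> w1 w2 n; split=> [|c u v Hu Hv] x y x0 y0.
    rewrite !word_act_cat !word_adj_cat word_act_cons word_adj_cons /=.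
    rewrite (semilin0 om) !(semilin0 (smode_is_linl _ _)).
    rewrite (semilin0 (word_act_is_lin _)) (semilin0 (word_adj_is_lin _ _)).
    by rewrite (semilin0 (bZl _)) (semilin0 (bZr _)).
  have := Hv x y x0 y0; have := Hu x y x0 y0.
  rewrite !word_act_cat !word_adj_cat !word_act_cons !word_adj_cons /=.
  rewrite om !smode_is_linl word_act_is_lin word_adj_is_lin bZl bZr /= conjCK.
  by move=> -> ->.
move=> w1 w2 g h k l p q c d n m hc hd Pshort Pswap x y x0 y0.
have [e He] := comm_adjoint M HGam Hphi HUps Hcompat Homega n m hc hd.
have := Pswap x y x0 y0; have := Pshort e x y x0 y0.
rewrite !word_act_cat !word_adj_cat !word_act_cons !word_adj_cons /=.
have [/eqP E1 _] := He (word_act w2 y); have [_ /eqP E2] := He (adj w1 x).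
move: E1 E2; rewrite !subr_eq => /eqP -> /eqP ->.
rewrite (semilinD (word_act_is_lin _)) (semilinD (word_adj_is_lin _ _)).
rewrite (semilinZ (word_act_is_lin _)) (semilinZ (word_adj_is_lin _ _)).
rewrite (semilinD (bZr _)) (semilinD (bZl _)) (semilinZ (bZr _)) (semilinZ (bZl _)) /=.
by rewrite psign_conj => -> ->.
Qed.

(** The functional f_x of the extension argument. The type [R[i]^o] views the scalars as a module,
    so that the lemmas on [semilin] apply. *)
Definition adapted (x : M) (f : M -> R[i]^o) : Prop :=
  lin f /\ forall w y, Mgr 0 y -> f (word_act w y) = b (adj w x) y.

Lemma adapted_unique x f f' : adapted x f -> adapted x f' -> f = f'.
Proof.
move=> [fL fw] [fL' fw']; apply/funext; apply: word_gen.
  split=> [|c y z /= Hy Hz]; first by rewrite /= (semilin0 fL) (semilin0 fL').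
  by rewrite fL fL' Hy Hz.
by move=> w v v0 /=; rewrite fw // fw'.
Qed.

Lemma adapted_lin c x y f f' : adapted x f -> adapted y f' ->
  adapted (c *: x + y) (fun z => c^* *: f z + f' z).
Proof.
move=> [fL fw] [fL' fw']; split=> [d u v|w v v0].
  rewrite fL fL' /= !scalerDr !scalerA [d * _]mulrC addrACA.
  by [].
by rewrite word_adj_is_lin bZl fw // fw'.
Qed.

Lemma adapted_smode a n x f : adapted x f ->
  adapted (smode (omega phi a) (- n) x) (fun y => f (smode a n y)).
Proof.
move=> [fL fw]; split=> [d u v|w v v0]; first by rewrite smode_is_linr fL.
by rewrite -(word_act_cons (a, n)) fw.
Qed.

Lemma adapted_base x : Mgr 0 x -> adapted x (b x).
Proof. by move=> x0; split=> [|w y y0]; [exact: bZr | exact: word_adjoint]. Qed.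

Lemma adapted_exists x : exists f, adapted x f.
Proof.
move: x; apply: smode_gen.
- split=> [|c x y [f Hf] [f' Hf']]; last first.
    by exists (fun z => c^* *: f z + f' z); exact: adapted_lin.
  by exists (b 0); apply: adapted_base; exact: (Mgr_subspace HM 0).1.
- by move=> x x0; exists (b x); exact: adapted_base.
(* By omega^2 = 1, a_n is itself the adjoint of omega(a) in degree -n. *)
move=> a n x [f Hf]; exists (fun y => f (smode (omega phi a) (- n) y)).
by have := adapted_smode (omega phi a) (- n) Hf; rewrite (omegaK Hphi) opprK.
Qed.

Lemma invariant_extension : exists B : M -> M -> R[i],
  [/\ hermitian_form B, mode_invariant phi B &
      forall x y, Mgr 0 x -> B x y = b x y].
Proof.
have [B HB] := choice adapted_exists.
have Binv : mode_invariant phi B.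
  move=> a n x y.
  by rewrite (adapted_unique (HB (smode (omega phi a) (- n) x)) (adapted_smode a n (HB x))).
have B0 x : Mgr 0 x -> B x = b x.
  by move=> x0; apply: adapted_unique (HB x) (adapted_base x0).
have Bl c x y : B (c *: x + y) = (fun z => c^* *: B x z + B y z).
  exact: adapted_unique (HB _) (adapted_lin c (HB x) (HB y)).
have Blin z : semilin conjR ((fun x => B x z) : M -> R[i]^o).
  by move=> c x y; rewrite Bl.
have Br x : lin (B x) by case: (HB x).
have Binv' a n x y : B (smode a n x) y = B x (smode (omega phi a) (- n) y).
  by rewrite Binv (omegaK Hphi) opprK.
have Bw w x y : B (word_act w x) y = B x (adj w y).
  elim: w y => //= l w IH y; by rewrite Binv' IH.
exists B; split=> //; last by move=> x y x0; rewrite B0.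
split.
- by move=> c x y z; rewrite Bl.
- by move=> c x y z; rewrite Br.
move=> x; apply: word_gen.
  split=> [|c y z /= Hy Hz].
    by rewrite /= (semilin0 (Br x)) (semilin0 (Blin x)) rmorph0.
  by rewrite Br Bl Hy Hz rmorphD rmorphM /= conjCK.
(* Symmetry is checked on words: moving [w] to the other argument reduces it to the symmetry of
   [b]. *)
move=> w y y0 /=; rewrite (HB x).2 // Bw (B0 _ y0).
by case: Hb.
Qed.

End Extension.

(** * Restriction of forms to M_0 *)

Section Restriction.
Variables (R : realType) (Gam : set R) (V : conformalVA R) (phi : V -> V).
Variables (Ups : R -> set V) (M : twistedModule Gam Ups) (Mgr : R -> set M).
Hypothesis HGam : Gam = @int_set R \/ Gam = @half_int_set R.
Hypothesis Hphi : conj_involution phi.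
Hypothesis HUps : is_grading Gam Ups.
Hypothesis Hcompat : compatible_grading Gam Ups phi.
Hypothesis Homega : forall a : V, zhuV Gam Ups a -> zhuV Gam Ups (omega phi a).
Hypothesis HM : positive_energy Mgr.

Local Notation M0 := (subspace_type (min_energy HM)).
Local Notation zhuA := (zhu Gam Ups).

Lemma zhu_repr (s : subspace_type (zhuV Gam Ups)) :
  zhuJ Gam Ups (subspace_val (repr (\pi_zhuA%qT s)) - subspace_val s).
Proof.
have /eqmodP/asboolP // : (repr (\pi_zhuA%qT s) = s %[mod zhuA])%qT by rewrite reprK.
Qed.

(** Independence of the representative: J and omega(J) both act by zero on M_0. *)
Lemma zhu_repr_act (s : subspace_type (zhuV Gam Ups)) (v : M) : Mgr 0 v ->
  let a := subspace_val (repr (\pi_zhuA%qT s)) in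
  smode a 0 v = smode (subspace_val s) 0 v /\
  smode (omega phi a) 0 v = smode (omega phi (subspace_val s)) 0 v.
Proof.
move=> v0 a.
have [] := zhuJ_act HGam Hphi HUps Hcompat Homega HM (zhu_repr s) v0.
rewrite -/a (semilinB (omega_semilin Hphi)) !(semilinB (smode_is_linl _ _)).
by split; apply/eqP; rewrite -subr_eq0; apply/eqP.
Qed.

Lemma zhu_actE (x : zhuA) (v : M0) :
  subspace_val (zhu_act x v) = smode (subspace_val (repr x)) 0 (subspace_val v).
Proof. exact: zero_modeE. Qed.

Lemma zhu_act_omegaE (x : zhuA) (v : M0) :
  subspace_val (zhu_act (zhu_omega Homega x) v) =
  smode (omega phi (subspace_val (repr x))) 0 (subspace_val v).
Proof.
rewrite zhu_actE /zhu_omega.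
by have [-> _] := zhu_repr_act
  (in_subspace (Homega (subspace_valU (repr x)))) (subspace_valU v).
Qed.

Lemma M0_val_lin (c : R[i]) (x y : M0) :
  subspace_val (c *: x + y) = c *: subspace_val x + subspace_val y.
Proof. by []. Qed.

Definition form_restrict (B : M -> M -> R[i]) : M0 -> M0 -> R[i] :=
  fun x y => B (subspace_val x) (subspace_val y).

Lemma form_restrict_omega B : phi_forms M phi B -> omega_forms HM Homega (form_restrict B).
Proof.
move=> [HB /(phi_invariantE Hphi HB) Binv]; split.
  case: HB => H1 H2 H3; split=> *; rewrite /form_restrict ?M0_val_lin //; exact: H3.
move=> x m1 m2; rewrite /form_restrict zhu_act_omegaE zhu_actE Binv.
by rewrite oppr0.
Qed.

Definition M0_proj (v : M) : M0 := in_subspace (proj0_in HM v : min_energy HM _).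

Lemma M0_inj (x y : M0) : subspace_val x = subspace_val y -> x = y.
Proof. exact: val_inj. Qed.

Lemma M0_proj_val v : subspace_val (M0_proj v) = proj0 Mgr v.
Proof. by []. Qed.

Lemma M0_proj_lin c x y : M0_proj (c *: x + y) = c *: M0_proj x + M0_proj y.
Proof. apply: M0_inj; rewrite M0_val_lin !M0_proj_val; exact: proj0_is_lin. Qed.

Lemma M0_projK (x : M0) : M0_proj (subspace_val x) = x.
Proof. by apply: M0_inj; apply: (proj0_id HM); exact: (subspace_valU x). Qed.

Lemma M0_proj0 v : M0_proj (proj0 Mgr v) = M0_proj v.
Proof. by apply: M0_inj; apply: (proj0_id HM); exact: proj0_in. Qed.

(** Passes from V_Upsilon to all of V. For a homogeneous [a] degree 0 is either admissible, and then
    [a] lies in V_Upsilon, or not, and then a_0 and omega(a)_0 both vanish. *)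
Lemma omega_form_zero_mode (B0 : M0 -> M0 -> R[i]) : omega_forms HM Homega B0 ->
  let b x y := B0 (M0_proj x) (M0_proj y) in
  forall a x y, Mgr 0 x -> Mgr 0 y ->
    b x (smode a 0 y) = b (smode (omega phi a) 0 x) y.
Proof.
move=> [[H1 H2 H3] B0inv] b a x y x0 y0.
have Hb : hermitian_form b.
  by split=> *; rewrite /b ?M0_proj_lin ?H1 ?H2 // -H3.
have br := form_linr Hb; have bl := form_linl Hb.
move: a; apply: (hom_ind HGam HUps).
  split=> [|c u v /= Hu Hv].
    rewrite /= (semilin0 (omega_semilin Hphi)) !(semilin0 (smode_is_linl _ _)).
    by rewrite (semilin0 (br _)) (semilin0 (bl _)).
  rewrite (omega_semilin Hphi) !smode_is_linl (br x) (bl y) Hu Hv /=.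
  by rewrite conjCK.
move=> g k p a ha /=; have [Gg ga ka _] := ha.
have [ad|nad] := pselect (adm g k 0); last first.
  rewrite (smode_supp _ ha nad) -[X in smode _ X x]oppr0.
  rewrite (smode_omega_supp HGam Hphi HUps Hcompat Homega _ ha nad).
  by rewrite (semilin0 (br _)) (semilin0 (bl _)).
have Za : zhuV Gam Ups a.
  move=> U _; apply; exists g, k; split=> //; apply/max_nonpos_int.
  by move: ad => /int_setN; rewrite /adm add0r opprB.
pose s := in_subspace Za; pose z := \pi_zhuA%qT s.
have val_smode c v : Mgr 0 v -> Mgr 0 (smode c 0 v).
  by move=> v0; rewrite -[X in Mgr X]subr0; exact: smode_degree.
have := B0inv z (M0_proj x) (M0_proj y).
have -> : zhu_act z (M0_proj y) = M0_proj (smode a 0 y).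
  apply: M0_inj; rewrite zhu_actE !M0_proj_val (proj0_id HM y0)
    (proj0_id HM (val_smode _ _ y0)).
  by have [-> _] := zhu_repr_act s y0.
have -> : zhu_act (zhu_omega Homega z) (M0_proj x) = M0_proj (smode (omega phi a) 0 x).
  apply: M0_inj; rewrite zhu_act_omegaE !M0_proj_val (proj0_id HM x0)
    (proj0_id HM (val_smode _ _ x0)).
  by have [_ ->] := zhu_repr_act s x0.
by move=> /esym.
Qed.

Hypothesis Hgen : generated_by (Mgr 0).

(** Reduction by [word_ind]: a word with a raising letter on the left is orthogonal to M_0, as the
    adjoint of that letter kills M_0, and it has no component in M_0. *)
Lemma invariant_proj0 (B : M -> M -> R[i]) : hermitian_form B ->
  mode_invariant phi B ->
  forall x y, Mgr 0 x -> B x y = B x (proj0 Mgr y).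
Proof.
move=> HB Binv.
have Br := form_linr HB; have Bl := form_linl HB.
have pl := proj0_is_lin HM.
suff H w : forall x y, Mgr 0 x -> Mgr 0 y ->
    B x (word_act w y) = B x (proj0 Mgr (word_act w y)).
  move=> x y x0; move: y; apply: (word_gen Hgen).
    split=> [|c y z /= Hy Hz]; first by rewrite /= (semilin0 pl).
    by rewrite pl !Br Hy Hz.
  by move=> w y y0 /=; exact: H.
pose P w := forall x y, Mgr 0 x -> Mgr 0 y ->
  B x (word_act w y) = B x (proj0 Mgr (word_act w y)).
suff : P w by apply.
move: w; apply: (word_ind HGam HUps).
- by move=> x y x0 y0; rewrite (proj0_id HM).
- move=> w c k k0 x y x0 y0; rewrite -cats1 word_act_cat /=.
  rewrite (smode_lowering HGam HUps HM c k0 y0) (semilin0 (word_act_is_lin w)).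
  by rewrite (semilin0 pl).
- move=> w c IH x y x0 y0; rewrite -cats1 word_act_cat /= -IH //.
  by rewrite -[X in Mgr X]subr0; exact: smode_degree.
- move=> w c k k0 x y x0 y0; rewrite word_act_cons /=.
  have [j Hj] := word_act_degree HGam HUps HM w y0.
  rewrite (proj0_raising HGam HUps HM _ Hj) // Binv.
  rewrite (smode_lowering HGam HUps HM) ?oppr_gt0 //.
  by rewrite (semilin0 (Br _)) (semilin0 (Bl _)).
- move=> w1 w2 n; split=> [|c u v Hu Hv] x y x0 y0.
    rewrite word_act_cat word_act_cons /= (semilin0 (smode_is_linl _ _)).
    by rewrite (semilin0 (word_act_is_lin _)) (semilin0 pl).
  have := Hv x y x0 y0; have := Hu x y x0 y0.
  rewrite !word_act_cat !word_act_cons /=.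
  by rewrite smode_is_linl word_act_is_lin pl !Br => -> ->.
move=> w1 w2 g h k l p q c d n m hc hd Pshort Pswap x y x0 y0.
have [e He] := comm_adjoint M HGam Hphi HUps Hcompat Homega n m hc hd.
have := Pswap x y x0 y0; have := Pshort e x y x0 y0.
rewrite !word_act_cat !word_act_cons /=.
have [/eqP E1 _] := He (word_act w2 y).
move: E1; rewrite subr_eq => /eqP ->.
rewrite (semilinD (word_act_is_lin _)) (semilinZ (word_act_is_lin _)).
by rewrite (semilinD pl) (semilinZ pl) !(semilinD (Br _)) !(semilinZ (Br _)) => -> ->.
Qed.

(** Agreement spreads from M_0 x M_0 to M_0 x M by [invariant_proj0], then to M x M by moving modes
    from the second argument to the first. *)
Lemma invariant_unique (B B' : M -> M -> R[i]) :
  hermitian_form B -> mode_invariant phi B ->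
  hermitian_form B' -> mode_invariant phi B' ->
  (forall x y, Mgr 0 x -> Mgr 0 y -> B x y = B' x y) -> B = B'.
Proof.
move=> HB Binv HB' Binv' E.
have Br := form_linr HB; have Br' := form_linr HB'.
have E0 x y : Mgr 0 x -> B x y = B' x y.
  move=> x0; rewrite (invariant_proj0 HB Binv) // (invariant_proj0 HB' Binv') //.
  by apply: E => //; exact: proj0_in.
suff H y : forall x, B x y = B' x y by apply/funext => x; apply/funext => y; exact: H.
move: y; apply: (smode_gen Hgen).
- split=> [x|c y z /= Hy Hz x]; first by rewrite (semilin0 (Br x)) (semilin0 (Br' x)).
  by rewrite (Br x) (Br' x) Hy Hz.
- move=> y y0 x; case: HB => _ _ ->; case: HB' => _ _ ->.
  by rewrite E0.
- by move=> a n y Hy x; rewrite Binv Binv' Hy.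
Qed.

End Restriction.
Theorem proposition6p7 (R : realType) (Gam : set R) (V : conformalVA R)
  (phi : V -> V) (Ups : R -> set V) (M : twistedModule Gam Ups)
  (Mgr : R -> set M)
  (HGam : Gam = @int_set R \/ Gam = @half_int_set R)
  (Hphi : conj_involution phi)
  (HUps : is_grading Gam Ups)
  (Hcompat : compatible_grading Gam Ups phi)
  (Homega : forall a : V, zhuV Gam Ups a -> zhuV Gam Ups (omega phi a))
  (HM : positive_energy Mgr)
  (Hgen : generated_by (Mgr 0)) :
  real_isomorphic (phi_forms M phi) (omega_forms HM Homega).
Proof.
exists (form_restrict (HM := HM)); split=> //; split.
- by move=> B; exact: form_restrict_omega.
- move=> B B' /set_mem[HB /(phi_invariantE Hphi HB) Binv].
  move=> /set_mem[HB' /(phi_invariantE Hphi HB') Binv'] E.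
  apply: (invariant_unique HGam Hphi HUps Hcompat Homega HM Hgen HB Binv HB' Binv').
  move=> x y x0 y0.
  pose x' : subspace_type (min_energy HM) := in_subspace (x0 : min_energy HM x).
  pose y' : subspace_type (min_energy HM) := in_subspace (y0 : min_energy HM y).
  by rewrite -[LHS]/(form_restrict B x' y') E.
(* Surjectivity: [b] is the extension of [B0] by zero, the input of [invariant_extension]. *)
move=> B0 HB0; pose b x y := B0 (M0_proj HM x) (M0_proj HM y).
have Hb : hermitian_form b.
  by case: HB0.1 => H1 H2 H3; split=> *; rewrite /b ?M0_proj_lin ?H1 ?H2 // -H3.
have bp x y : b x y = b (proj0 Mgr x) (proj0 Mgr y) by rewrite /b !M0_proj0.
have bz := omega_form_zero_mode HGam Hphi HUps Hcompat HB0.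
have [B [HB Binv BE]] := invariant_extension HGam Hphi HUps Hcompat Homega HM Hgen Hb bp bz.
exists B; first by split=> //; apply/(phi_invariantE Hphi HB).
apply/funext => x; apply/funext => y; rewrite /form_restrict BE.
  by rewrite /b !M0_projK.
exact: (subspace_valU x).
Qed.
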